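(* Let $d,n$ be positive integers and let $\boldsymbol{\lambda}=(\boldsymbol{\lambda}^{(1)},\dots,\boldsymbol{\lambda}^{(d)})$ be a $d$-partition of $n$. Then $V_{\boldsymbol{\lambda}}$ is an irreducible representation of $\mathbb{C}(q){\rm FTL}_{d,n}(q)$ (that is, the irreducible representation $V_{\boldsymbol{\lambda}}$ of $\mathbb{C}(q){\rm Y}_{d,n}(q)$ factors through the quotient $\mathbb{C}(q){\rm FTL}_{d,n}(q)$) if and only if the Young diagram of $\boldsymbol{\lambda}^{(i)}$ has at most two columns for all $i=1,\ldots,d$.
   Context: Let $q$ be an indeterminate. The Yokonuma--Hecke algebra ${\rm Y}_{d,n}(q)$ is the associative unital $\mathbb{C}[q,q^{-1}]$-algebra generated by $g_1,\dots,g_{n-1},t_1,\dots,t_n$ with relations: $g_ig_j=g_jg_i$ if $|i-j|>1$; $g_ig_{i+1}g_i=g_{i+1}g_ig_{i+1}$ for $1\le i\le n-2$; $t_it_j=t_jt_i$; $t_jg_i=g_it_{s_i(j)}$ where $s_i=(i,i+1)\in\mathfrak{S}_n$; $t_j^d=1$; and $g_i^2=q+(q-1)e_ig_i$, where $e_i=\frac1d\sum_{s=0}^{d-1}t_i^st_{i+1}^{-s}$. Framisation of the Temperley--Lieb algebra: ${\rm FTL}_{d,n}(q)={\rm Y}_{d,n}(q)/I_{d,n}$, where $I_{d,n}$ is the two-sided ideal generated by $e_1e_2\,g_{1,2}$ with $g_{1,2}=1+g_1+g_2+g_1g_2+g_2g_1+g_1g_2g_1$ (and $I_{d,n}=\{0\}$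 if $n\le 2$). Write $\mathbb{C}(q){\rm Y}_{d,n}(q)$ and $\mathbb{C}(q){\rm FTL}_{d,n}(q)$ for the algebras obtained by extension of scalars to $\mathbb{C}(q)$. A $d$-partition of $n$ is a $d$-tuple of (possibly empty) partitions whose sizes sum to $n$. A standard $d$-tableau $\mathcal{T}$ of shape $\boldsymbol{\lambda}$ is a bijective filling of the nodes of the Young diagrams of $\boldsymbol{\lambda}^{(1)},\dots,\boldsymbol{\lambda}^{(d)}$ by $1,\dots,n$ with entries increasing along rows and down columns in each diagram. If the number $i$ lies in row $x$ and column $y$ of the $k$-th diagram, put ${\rm p}_i={\rm p}(\mathcal{T}|i):=k$ and ${\rm c}_i={\rm c}(\mathcal{T}|i):=q^{y-x}$. For $\sigma\in\mathfrak{S}_n$, $\mathcal{T}^\sigma$ is obtained from $\mathcal{T}$ by applying $\sigma$ to the entries. Let $\{\xi_1,\dots,\xi_d\}$ be the set of all complex $d$-th roots of unity (ordered arbitrarily). $V_{\boldsymbol{\lambda}}$ is the $\mathbb{C}(q)$-vector space with basis $\{\mathbf{v}_{\mathcal{T}}\}$ indexed by the standard $d$-tableaux of shape $\boldsymbol{\lambda}$ (with $\mathbf{v}_{\mathcal{T}}:=0$ for non-standard $\mathcal{T}$), with action $t_j(\mathbf{v}_{\mathcal{T}})=\xi_{{\rm p}_j}\mathbf{v}_{\mathcal{T}}$; and $g_i(\mathbf{v}_{\mathcal{T}})=\mathbf{v}_{\mathcal{T}^{s_i}}$ if ${\rm p}_i>{\rm p}_{i+1}$; $g_i(\mathbf{v}_{\mathcal{T}})=q\,\mathbf{v}_{\mathcal{T}^{s_i}}$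 if ${\rm p}_i<{\rm p}_{i+1}$; $g_i(\mathbf{v}_{\mathcal{T}})=\frac{q{\rm c}_{i+1}-{\rm c}_{i+1}}{{\rm c}_{i+1}-{\rm c}_i}\mathbf{v}_{\mathcal{T}}+\frac{q{\rm c}_{i+1}-{\rm c}_i}{{\rm c}_{i+1}-{\rm c}_i}\mathbf{v}_{\mathcal{T}^{s_i}}$ if ${\rm p}_i={\rm p}_{i+1}$. It is known that the $V_{\boldsymbol{\lambda}}$, for $\boldsymbol{\lambda}$ running over the $d$-partitions of $n$, form a complete set of pairwise non-isomorphic irreducible representations of $\mathbb{C}(q){\rm Y}_{d,n}(q)$. *)

(* Defs.v *)
From HB Require Import structures.
From mathcomp Require Import all_boot all_order all_algebra.
From mathcomp Require Import perm.
From mathcomp Require Import boolp reals complex.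
From mathcomp.multinomials Require Import monalg.

Set Implicit Arguments.
Unset Strict Implicit.
Unset Printing Implicit Defensive.

Import GRing.Theory.
Local Open Scope ring_scope.
Local Open Scope quotient_scope.

(* Associative unital algebras over a commutative ring K, given by their      *)
(* structure map K -> A. MathComp's algType also requires 1 != 0, which is    *)
(* not known in advance for an algebra defined by generators and relations.   *)
HB.mixin Record isAssocAlgebra (K : comNzRingType) A of GRing.PzRing A := {
  scal : K -> A;
  scal1 : scal 1 = 1;
  scalD : {morph scal : a b / a + b};
  scalM : {morph scal : a b / a * b};
  scalC : forall c x, scal c * x = x * scal c
}.

#[short(type="assocAlgType")]
HB.structure Definition AssocAlgebra (K : comNzRingType) :=
  {A of GRing.PzRing A & isAssocAlgebra K A}.

Section Quotient.
Variables (K : comNzRingType) (A : assocAlgType K).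

(* The two-sided ideal generated by S. *)
Inductive ideal_gen (S : A -> Prop) : A -> Prop :=
| IdealGen x of S x : ideal_gen S x
| Ideal0 : ideal_gen S 0
| IdealD x y of ideal_gen S x & ideal_gen S y : ideal_gen S (x + y)
| IdealMl a x of ideal_gen S x : ideal_gen S (a * x)
| IdealMr x a of ideal_gen S x : ideal_gen S (x * a).

Variable S : A -> Prop.

Definition in_ideal : {pred A} := fun x => `[< ideal_gen S x >].

Lemma in_idealP x : reflect (ideal_gen S x) (x \in in_ideal).
Proof. exact: asboolP. Qed.

Lemma in_ideal_zmod_closed : zmod_closed in_ideal.
Proof.
split=> [|x y /in_idealP Ix /in_idealP Iy]; first by apply/in_idealP/Ideal0.
by apply/in_idealP/IdealD => //; rewrite -mulN1r; apply: IdealMl.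
Qed.

HB.instance Definition _ :=
  GRing.isZmodClosed.Build A in_ideal in_ideal_zmod_closed.

Definition quotAlg := Quotient.quot in_ideal.

HB.instance Definition _ := GRing.Zmodule.copy quotAlg (Quotient.quot in_ideal).
HB.instance Definition _ : EqQuotient A (Quotient.equiv in_ideal) quotAlg :=
  EqQuotient.on quotAlg.

Definition quot_pi (x : A) : quotAlg := \pi_quotAlg x.

Lemma quot_piP x y : reflect (ideal_gen S (x - y)) (quot_pi x == quot_pi y).
Proof. by rewrite piE; apply: asboolP. Qed.

Lemma quot_piK x : quot_pi (repr x) = x.
Proof. exact: reprK. Qed.

Lemma quot_piD x y : quot_pi (x + y) = quot_pi x + quot_pi y.
Proof. exact: (@Quotient.pi_add A in_ideal). Qed.

Lemma repr_quot_pi x : ideal_gen S (repr (quot_pi x) - x).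
Proof. by apply/quot_piP/eqP; rewrite quot_piK. Qed.

Definition quot_mul (x y : quotAlg) : quotAlg := quot_pi (repr x * repr y).

Lemma quot_mulE x y : quot_mul (quot_pi x) (quot_pi y) = quot_pi (x * y).
Proof.
apply/eqP/quot_piP; set x' := repr _; set y' := repr _.
rewrite -(subrK (x * y') (x' * y')) -addrA -mulrBl -mulrBr.
by apply: IdealD; [apply: IdealMr | apply: IdealMl]; apply: repr_quot_pi.
Qed.

Lemma quot_mulA : associative quot_mul.
Proof.
move=> x y z; rewrite -(quot_piK x) -(quot_piK y) -(quot_piK z).
by rewrite !quot_mulE mulrA.
Qed.

Lemma quot_mul1l : left_id (quot_pi 1) quot_mul.
Proof. by move=> x; rewrite -(quot_piK x) quot_mulE mul1r. Qed.

Lemma quot_mul1r : right_id (quot_pi 1) quot_mul.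
Proof. by move=> x; rewrite -(quot_piK x) quot_mulE mulr1. Qed.

Lemma quot_mulDl : left_distributive quot_mul +%R.
Proof.
move=> x y z; rewrite -(quot_piK x) -(quot_piK y) -(quot_piK z).
by rewrite -quot_piD !quot_mulE mulrDl quot_piD.
Qed.

Lemma quot_mulDr : right_distributive quot_mul +%R.
Proof.
move=> x y z; rewrite -(quot_piK x) -(quot_piK y) -(quot_piK z).
by rewrite -quot_piD !quot_mulE mulrDr quot_piD.
Qed.

HB.instance Definition _ := GRing.Zmodule_isPzRing.Build quotAlg
  quot_mulA quot_mul1l quot_mul1r quot_mulDl quot_mulDr.

Lemma quot_piM x y : quot_pi (x * y) = quot_pi x * quot_pi y.
Proof. by rewrite -quot_mulE. Qed.

Lemma quot_pi1 : quot_pi 1 = 1.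
Proof. by []. Qed.

Definition quot_scal (c : K) : quotAlg := quot_pi (scal c).

Lemma quot_scal1 : quot_scal 1 = 1.
Proof. by rewrite /quot_scal scal1. Qed.

Lemma quot_scalD : {morph quot_scal : a b / a + b}.
Proof. by move=> a b; rewrite /quot_scal scalD quot_piD. Qed.

Lemma quot_scalM : {morph quot_scal : a b / a * b}.
Proof. by move=> a b; rewrite /quot_scal scalM quot_piM. Qed.

Lemma quot_scalC c x : quot_scal c * x = x * quot_scal c.
Proof. by rewrite -(quot_piK x) -!quot_piM scalC. Qed.

HB.instance Definition _ := isAssocAlgebra.Build K quotAlg
  quot_scal1 quot_scalD quot_scalM quot_scalC.

End Quotient.

Arguments quotAlg {K} A S.
Arguments quot_pi {K A} S x.

Section Presented.
Variables (K : comNzRingType) (X : choiceType).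

Definition freeAlg : Type := {malg K[{fmonom X}]}.

HB.instance Definition _ := GRing.NzRing.on freeAlg.

Definition free_scal (c : K) : freeAlg := c *: (1 : {malg K[{fmonom X}]}).

Lemma free_scal1 : free_scal 1 = 1.
Proof. exact: scale1r. Qed.

Lemma free_scalD : {morph free_scal : a b / a + b}.
Proof. by move=> a b; apply: scalerDl. Qed.

Lemma free_scalM : {morph free_scal : a b / a * b}.
Proof.
move=> a b; rewrite /free_scal -scalerA.
by rewrite -[in LHS](mul1r (b *: _)) scalerAl.
Qed.

Lemma free_scalC c x : free_scal c * x = x * free_scal c.
Proof.
have -> : free_scal c = (<< c *g mone >> : {malg K[{fmonom X}]}).
  by apply/malgP => k; rewrite mcoeffZ mcoeffU1 mcoeffU mulr_natr.
rewrite [LHS]fgmulUg [RHS]fgmulgU; apply: eq_bigr => k _.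
by rewrite mul1m mulm1 mulrC.
Qed.

HB.instance Definition _ := isAssocAlgebra.Build K freeAlg
  free_scal1 free_scalD free_scalM free_scalC.

Definition free_gen (x : X) : freeAlg := << fmu x >>.

Definition relators (rel : freeAlg -> freeAlg -> Prop) : freeAlg -> Prop :=
  fun z => exists x y, rel x y /\ z = x - y.

(* The K-algebra with generators X and relations x = y for rel x y. *)
Definition presented (rel : freeAlg -> freeAlg -> Prop) :=
  quotAlg freeAlg (relators rel).

HB.instance Definition _ rel := AssocAlgebra.on (presented rel).

Definition presented_gen rel (x : X) : presented rel :=
  quot_pi (relators rel) (free_gen x).

End Presented.


Section ScalarExtension.
Variables (k K : comNzRingType) (phi : {rmorphism k -> K}) (A : assocAlgType k).

(* The K-algebra generated by symbols [x], x in A, subject to the relations   *)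
(* that make x |-> [x] a morphism of k-algebras; [x] stands for 1 (x) x in    *)
(* the tensor product of K and A over k, which has this presentation.         *)
Inductive ext_rel : freeAlg K A -> freeAlg K A -> Prop :=
| ExtRel1 : ext_rel (free_gen K 1) 1
| ExtRelD x y : ext_rel (free_gen K (x + y)) (free_gen K x + free_gen K y)
| ExtRelM x y : ext_rel (free_gen K (x * y)) (free_gen K x * free_gen K y)
| ExtRelZ c x :
    ext_rel (free_gen K (scal c * x)) (scal (phi c) * free_gen K x).

Definition scalarExt := presented ext_rel.

HB.instance Definition _ := AssocAlgebra.on scalarExt.

Definition ext_in (x : A) : scalarExt := presented_gen ext_rel x.

End ScalarExtension.

Section Laurent.
Variable C : fieldType.

Local Notation Cq := {fraction {poly C}}.

Definition qvar : Cq := tofrac 'X.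

Lemma qvar_neq0 : qvar != 0.
Proof. by rewrite tofrac_eq0 polyX_eq0. Qed.

(* C[q, q^-1], as a subring of C(q). *)
Definition laurent : {pred Cq} :=
  fun x => `[< exists (p : {poly C}) (m : nat), x = tofrac p / qvar ^+ m >].

Lemma laurentP x :
  reflect (exists (p : {poly C}) (m : nat), x = tofrac p / qvar ^+ m)
    (x \in laurent).
Proof. exact: asboolP. Qed.

Lemma laurent_poly (p : {poly C}) : tofrac p \in laurent.
Proof. by apply/laurentP; exists p, 0%N; rewrite expr0 divr1. Qed.

Lemma laurent_subring_closed : subring_closed laurent.
Proof.
have q0 m : qvar ^+ m != 0 by rewrite expf_neq0 // qvar_neq0.
split=> [|x y|x y]; first by rewrite -tofrac1; apply: laurent_poly.
- move=> /laurentP[p [m ->]] /laurentP[r [l ->]]; apply/laurentP.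
  exists (p * 'X^l - r * 'X^m), (m + l)%N.
  rewrite tofracB !tofracM !tofracXn -/qvar exprD.
  by rewrite -mulNr addf_div ?mulNr ?q0.
- move=> /laurentP[p [m ->]] /laurentP[r [l ->]]; apply/laurentP.
  by exists (p * r), (m + l)%N; rewrite mulf_div tofracM exprD.
Qed.

HB.instance Definition _ :=
  GRing.isSubringClosed.Build Cq laurent laurent_subring_closed.

Definition laurentPoly := {x : Cq | x \in laurent}.

HB.instance Definition _ := SubChoice.on laurentPoly.
HB.instance Definition _ := [SubChoice_isSubComNzRing of laurentPoly by <:].

Definition laurent_to_frac : {rmorphism laurentPoly -> Cq} :=
  (val : laurentPoly -> Cq).

Definition laurent_of_poly (p : {poly C}) : laurentPoly :=
  exist _ (tofrac p) (laurent_poly p).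

End Laurent.

(* 'I_n.-1 indexes the generators g_1, ..., g_(n-1), shifted by one: g_ i     *)
(* involves the strands lo i = i and hi i = i + 1 of 'I_n.                    *)
Section Strands.
Variables (n : nat) (i : 'I_n.-1).

Lemma hi_subproof : (i.+1 < n)%N.
Proof. by rewrite -ltn_predRL. Qed.

Definition lo : 'I_n := widen_ord (leq_pred n) i.
Definition hi : 'I_n := Ordinal hi_subproof.
Definition sgen : {perm 'I_n} := tperm lo hi.

End Strands.

Section YokonumaHecke.
Variables (C : fieldType) (d n : nat).

Local Notation L := (laurentPoly C).
Local Notation q := (scal (laurent_of_poly ('X : {poly C}))).

(* The inverse of t_(i+1)^s is written t_(i+1)^(d-s), as t_(i+1)^d = 1.       *)
Definition idem_e (A : assocAlgType L) (t : 'I_n -> A) (i : 'I_n.-1) : A :=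
  scal (laurent_of_poly (d%:R^-1 : C)%:P) *
    \sum_(s < d) t (lo i) ^+ s * t (hi i) ^+ (d - s).

Definition yh_g (i : 'I_n.-1) : freeAlg L ('I_n.-1 + 'I_n)%type :=
  free_gen L (inl i).
Definition yh_t (j : 'I_n) : freeAlg L ('I_n.-1 + 'I_n)%type :=
  free_gen L (inr j).

Inductive yh_rel : freeAlg L ('I_n.-1 + 'I_n)%type ->
    freeAlg L ('I_n.-1 + 'I_n)%type -> Prop :=
| YHcomm (i j : 'I_n.-1) of (i.+1 < j)%N || (j.+1 < i)%N :
    yh_rel (yh_g i * yh_g j) (yh_g j * yh_g i)
| YHbraid (i j : 'I_n.-1) of j = i.+1 :> nat :
    yh_rel (yh_g i * yh_g j * yh_g i) (yh_g j * yh_g i * yh_g j)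
| YHtt i j : yh_rel (yh_t i * yh_t j) (yh_t j * yh_t i)
| YHtg i j : yh_rel (yh_t j * yh_g i) (yh_g i * yh_t (sgen i j))
| YHtd j : yh_rel (yh_t j ^+ d) 1
| YHquad i : yh_rel (yh_g i ^+ 2) (q + (q - 1) * idem_e yh_t i * yh_g i).

Definition YH := presented yh_rel.
HB.instance Definition _ := AssocAlgebra.on YH.

Definition YHg (i : 'I_n.-1) : YH := presented_gen yh_rel (inl i).
Definition YHt (j : 'I_n) : YH := presented_gen yh_rel (inr j).

Definition g12 (i j : 'I_n.-1) : YH :=
  1 + YHg i + YHg j + YHg i * YHg j + YHg j * YHg i + YHg i * YHg j * YHg i.

(* There are no such i and j when n <= 2, and then the ideal is zero.         *)
Definition ftl_gen (x : YH) : Prop :=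
  exists i j : 'I_n.-1, [/\ i = 0%N :> nat, j = 1%N :> nat &
    x = idem_e YHt i * idem_e YHt j * g12 i j].

Definition FTL := quotAlg YH ftl_gen.
HB.instance Definition _ := AssocAlgebra.on FTL.

Definition CqYH := scalarExt (@laurent_to_frac C) YH.
HB.instance Definition _ := AssocAlgebra.on CqYH.

Definition CqFTL := scalarExt (@laurent_to_frac C) FTL.
HB.instance Definition _ := AssocAlgebra.on CqFTL.

Definition YH_in (x : YH) : CqYH := ext_in (@laurent_to_frac C) x.
Definition FTL_in (x : FTL) : CqFTL := ext_in (@laurent_to_frac C) x.

End YokonumaHecke.

Section Representation.
Variables (K : fieldType) (A : assocAlgType K) (V : vectType K).

Definition representation (act : A -> V -> V) : Prop :=
  [/\ forall a, linear (act a),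
      forall a b v, act (a + b) v = act a v + act b v,
      forall a b v, act (a * b) v = act a (act b v) &
      forall c v, act (scal c) v = c *: v].

Definition irreducible (act : A -> V -> V) : Prop :=
  (exists v : V, v != 0) /\
  forall U : {vspace V}, (forall a v, v \in U -> act a v \in U) ->
    U = 0%VS \/ U = fullv.

End Representation.

Definition is_partition (sh : seq nat) : bool :=
  sorted geq sh && (0%N \notin sh).

Definition is_dpartition (d n : nat) (lam : 'I_d -> seq nat) : Prop :=
  (forall k, is_partition (lam k)) /\ (\sum_k sumn (lam k) = n)%N.

Definition ncolumns (sh : seq nat) : nat := head 0%N sh.

Section Tableaux.
Variables (d n : nat) (lam : 'I_d -> seq nat).

(* A node is (diagram, row, column); a filling by the numbers 1, ..., n is    *)
(* given as the map sending each entry to the node that contains it. The      *)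
(* nodes of a d-partition of n have row and column indices below n.           *)
Definition node := ('I_d * 'I_n * 'I_n)%type.
Definition tableau := {ffun 'I_n -> node}.

Definition young : {set node} :=
  [set u : node | (u.2 < nth 0 (lam u.1.1) u.1.2)%N].

Definition pos (T : tableau) (a : 'I_n) : 'I_d := (T a).1.1.
Definition trow (T : tableau) (a : 'I_n) : 'I_n := (T a).1.2.
Definition tcol (T : tableau) (a : 'I_n) : 'I_n := (T a).2.

Definition standard (T : tableau) : bool :=
  [&& injectiveb T, [set T a | a : 'I_n] == young &
    [forall a, forall b,
      [&& pos T a == pos T b, trow T a == trow T b & (tcol T a < tcol T b)%N]
      || [&& pos T a == pos T b, tcol T a == tcol T b &
             (trow T a < trow T b)%N]
      ==> (a < b)%N]].

Definition stdtab := {T : tableau | standard T}.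

(* The entry a of T^s is the image under s of the entry s^-1(a) of T.         *)
Definition tab_perm (T : tableau) (s : {perm 'I_n}) : tableau :=
  [ffun a => T ((s^-1)%g a)].

End Tableaux.

Section Vlambda.
Variables (C : fieldType) (d n : nat) (lam : 'I_d -> seq nat) (xi : 'I_d -> C).

Local Notation Cq := {fraction {poly C}}.
Local Notation q := (qvar C).

Definition Vlam : Type := {ffun stdtab n lam -> Cq^o}.
HB.instance Definition _ := Vector.on Vlam.

(* The basis vector of T if T is standard, and 0 otherwise. *)
Definition vtab (T : tableau d n) : Vlam :=
  [ffun S : stdtab n lam => (val S == T)%:R].

Definition content (T : tableau d n) (a : 'I_n) : Cq :=
  q ^ ((tcol T a)%:Z - (trow T a)%:Z).

Definition t_act (j : 'I_n) (T : tableau d n) : Vlam :=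
  tofrac (xi (pos T j))%:P *: vtab T.

Definition g_act (i : 'I_n.-1) (T : tableau d n) : Vlam :=
  let p := pos T (lo i) in let p' := pos T (hi i) in
  let c := content T (lo i) in let c' := content T (hi i) in
  let Ts := tab_perm T (sgen i) in
  if (p' < p)%N then vtab Ts
  else if (p < p')%N then q *: vtab Ts
  else ((q * c' - c') / (c' - c)) *: vtab T
       + ((q * c' - c) / (c' - c)) *: vtab Ts.

Definition Vlam_action (act : CqYH C d n -> Vlam -> Vlam) : Prop :=
  [/\ representation act,
      forall j (T : tableau d n), standard lam T ->
        act (YH_in (YHt C d j)) (vtab T) = t_act j T &
      forall i (T : tableau d n), standard lam T ->
        act (YH_in (YHg C d i)) (vtab T) = g_act i T].

(* The projection C(q)YH -> C(q)FTL maps YH_in x to FTL_in (quot_pi _ x), and *)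
(* the elements YH_in x span C(q)YH over C(q).                                *)
Definition factors_through_FTL (actY : CqYH C d n -> Vlam -> Vlam)
    (act : CqFTL C d n -> Vlam -> Vlam) : Prop :=
  forall (x : YH C d n) v,
    actY (YH_in x) v = act (FTL_in (quot_pi (@ftl_gen C d n) x)) v.

Definition Vlam_irreducible_FTL : Prop :=
  exists actY : CqYH C d n -> Vlam -> Vlam,
  exists act : CqFTL C d n -> Vlam -> Vlam,
    [/\ Vlam_action actY, representation act,
        factors_through_FTL actY act & irreducible act].

End Vlambda.

(* Main.v *)
(* All statements are checked on the basis vectors v_T, on which              *)
(* g_i v_T = a v_T + b v_(T^(s_i)), with a = 0 when i and i+1 lie in          *)
(* different diagrams; the relations of the Yokonuma-Hecke algebra become     *)
(* identities between the coefficients a and b. The elements t_j and          *)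
(* g_k ... g_1 g_1 ... g_k are diagonal in this basis and their joint         *)
(* eigenvalues separate the standard tableaux, while adjacent transpositions  *)
(* connect any two standard tableaux of the same shape; hence V_lambda is     *)
(* irreducible. The element e_1 e_2 commutes with g_1 and g_2 and projects    *)
(* onto the tableaux having 1, 2 and 3 in the same diagram. On those, 1 and 2 *)
(* are in a row or a column. In a column, g_1 v_T = - v_T and v_T is killed   *)
(* by g_(1,2) = (1 + g_2 + g_1 g_2) (1 + g_1). In a row, either 3 follows, in *)
(* which case g_(1,2) acts by (1 + q) (1 + q + q^2) <> 0, or there are two    *)
(* columns, 3 is below 1, and g_(1,2) v_T = 0 again.                          *)

Require Import Defs.
From HB Require Import structures.
From mathcomp Require Import all_boot all_order all_algebra.
From mathcomp Require Import perm zify ring.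
From mathcomp.multinomials Require Import monalg.

Set Implicit Arguments.
Unset Strict Implicit.
Unset Printing Implicit Defensive.

Import GRing.Theory.

(** * Standard tableaux *)

(** V_lambda factors through the quotient exactly when the single generator [e_1 e_2 g_{1,2}] acts
    on it by zero, and it then stays irreducible because the projection from [YH] to [FTL] is onto.
    The idempotents kill every tableau whose first three entries are not in one diagram. On the
    others [g_1] and [g_2] act as in the seminormal form of the Hecke algebra of S_3, where
    [g_{1,2}] is a multiple of the symmetrising idempotent. It survives only on the representation
    [g_1 = g_2 = q], that is, only when the first three entries can fill a row. If some diagram has
    three columns, such a tableau exists ([std_exists]) and the generator is nonzero on it
    ([ideal_not_killed]); with at most two columns it acts by zero ([ideal_killed]).

    The actions themselves must also be constructed. By [std_same_content], entries at distance at
    most two in the same diagram have different contents, so no denominator vanishes and the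
    defining relations become rational identities ([rep_quad], [rep_braid]). The lifting lemmas turn
    the verified relations into homomorphisms to the endomorphism ring.

    Irreducibility is [stable_full]: the joint spectrum of the [t_j] and the Jucys-Murphy elements
    isolates a basis vector from any nonzero vector ([std_separation], resting on [std_determined]),
    and adjacent exchanges reach all the other ones ([std_connected]). *)

Section Swap.
Variables (d n : nat) (i : 'I_n.-1).
Implicit Types T : tableau d n.

Lemma tab_swapE T a : tab_perm T (sgen i) a = T (sgen i a).
Proof. by rewrite ffunE tpermV. Qed.

Lemma sgenL : sgen i (lo i) = hi i. Proof. exact: tpermL. Qed.
Lemma sgenR : sgen i (hi i) = lo i. Proof. exact: tpermR. Qed.

Lemma sgenD (a : 'I_n) : a != i :> nat -> a != i.+1 :> nat -> sgen i a = a.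
Proof.
by move=> ai ai1; rewrite tpermD // -val_eqE eq_sym.
Qed.

Lemma lo_neq_hi : lo i != hi i.
Proof. by rewrite -val_eqE /= neq_ltn ltnSn. Qed.

Lemma tab_swapK T : tab_perm (tab_perm T (sgen i)) (sgen i) = T.
Proof. by apply/ffunP=> a; rewrite !tab_swapE tpermK. Qed.

Lemma tab_swap_lo T : tab_perm T (sgen i) (lo i) = T (hi i).
Proof. by rewrite tab_swapE sgenL. Qed.

Lemma tab_swap_hi T : tab_perm T (sgen i) (hi i) = T (lo i).
Proof. by rewrite tab_swapE sgenR. Qed.

Lemma tab_swapD T (a : 'I_n) :
  a != i :> nat -> a != i.+1 :> nat -> tab_perm T (sgen i) a = T a.
Proof. by move=> ai ai1; rewrite tab_swapE sgenD. Qed.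

Lemma sgenE (c : 'I_n) : sgen i c =
  (if c == i :> nat then i.+1 else if c == i.+1 :> nat then i : nat else c) :> nat.
Proof.
case: ifP => [/eqP e|ci]; first by rewrite (_ : c = lo i) ?sgenL //; apply: val_inj.
case: ifP => [/eqP e|ci1]; first by rewrite (_ : c = hi i) ?sgenR //; apply: val_inj.
by rewrite sgenD /= ?ci ?ci1.
Qed.

Lemma sgen_lt (a b : 'I_n) :
  ~~ ((a == lo i) && (b == hi i)) -> (a < b)%N -> (sgen i a < sgen i b)%N.
Proof. by rewrite !sgenE -!val_eqE /=; do ![case: eqP => /= ?]; lia. Qed.

End Swap.

Lemma tab_swap_far d n (i j : 'I_n.-1) (T : tableau d n) :
    (i.+1 < j)%N || (j.+1 < i)%N ->
  tab_perm T (sgen i) (lo j) = T (lo j) /\ tab_perm T (sgen i) (hi j) = T (hi j).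
Proof. by move=> ij; split; apply: tab_swapD => /=; lia. Qed.

(** Nested applications of [sgenE] put conditionals inside conditions; splitting the innermost first
    leaves only linear arithmetic. *)
Ltac case_innermost_if := repeat
  match goal with |- context [if ?b then _ else _] =>
    lazymatch b with context [if _ then _ else _] => fail | _ => case: (boolP b) => ? end
  end.

Lemma tab_swapC d n (i j : 'I_n.-1) (T : tableau d n) :
    (i.+1 < j)%N || (j.+1 < i)%N ->
  tab_perm (tab_perm T (sgen i)) (sgen j) = tab_perm (tab_perm T (sgen j)) (sgen i).
Proof.
move=> ij; apply/ffunP => a; rewrite !tab_swapE; congr (T _); apply: val_inj.
by rewrite /= !sgenE; case_innermost_if; lia.
Qed.

Lemma tab_swap_braid d n (i j : 'I_n.-1) (T : tableau d n) : j = i.+1 :> nat ->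
  tab_perm (tab_perm (tab_perm T (sgen i)) (sgen j)) (sgen i) =
  tab_perm (tab_perm (tab_perm T (sgen j)) (sgen i)) (sgen j).
Proof.
move=> ij; apply/ffunP => a; rewrite !tab_swapE; congr (T _); apply: val_inj.
by rewrite /= !sgenE; case_innermost_if; lia.
Qed.

(** * Nodes, their partial order and their contents *)

Section Nodes.
Variables d n : nat.
Implicit Types (u v : node d n).

Definition node_le u v :=
  [&& u.1.1 == v.1.1, (u.1.2 <= v.1.2)%N & (u.2 <= v.2)%N].

Definition node_rclt u v :=
  (u.1.1 == v.1.1) && ((u.1.2 == v.1.2) && (u.2 < v.2)%N
                       || (u.2 == v.2) && (u.1.2 < v.1.2)%N).

(** The exponent of q in the content of a node. *)
Definition ncontent u : int := (u.2%:Z - u.1.2%:Z)%R.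

Lemma node_leP u v :
  reflect [/\ u.1.1 = v.1.1, u.1.2 <= v.1.2 & u.2 <= v.2]%N (node_le u v).
Proof. by apply: (iffP and3P) => -[/eqP]. Qed.

Lemma node_rclt_le u v : node_rclt u v -> node_le u v && (u != v).
Proof.
case: u v => [[k x] y] [[k' x'] y'] /andP[/= /eqP-> H].
rewrite /node_le eqxx !xpair_eqE -!val_eqE /=.
by move: H; rewrite -!val_eqE /=; lia.
Qed.

(** Of two incomparable nodes one is strictly above and strictly to the right of the other, which
    moves the content by at least 2. *)
Lemma close_comparable u v : u.1.1 = v.1.1 ->
  (`|ncontent u - ncontent v|%N <= 1)%N -> node_le u v || node_le v u.
Proof.
rewrite /node_le /ncontent => ->; rewrite eqxx /=; lia.
Qed.

End Nodes.

(** * Positions of nearby entries in a standard tableau *)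

Section Standard.
Variables (d n : nat) (lam : 'I_d -> seq nat).
Hypothesis hlam : is_dpartition n lam.
Implicit Types (T : tableau d n).

Lemma part_nth k i j : (i <= j)%N -> (nth 0 (lam k) j <= nth 0 (lam k) i)%N.
Proof.
move=> ij; have /andP[srt _] := hlam.1 k.
have [js|sj] := ltnP j (size (lam k)); last by rewrite nth_default.
have gtr : transitive geq by move=> a b c /= ab bc; apply: leq_trans bc ab.
apply: (sorted_leq_nth gtr _ 0 srt) => //; first exact: leqnn.
by rewrite inE (leq_ltn_trans ij).
Qed.

Lemma young_le u v : v \in young n lam -> node_le u v -> u \in young n lam.
Proof.
case: u v => [[k x] y] [[k' x'] y']; rewrite !inE /= => yv /node_leP/= [-> xx yy].
by apply: leq_ltn_trans yy (leq_trans yv _); apply: part_nth.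
Qed.

Lemma standardP T : reflect
  [/\ injective T, forall a, T a \in young n lam,
      forall u, u \in young n lam -> exists a, T a = u &
      forall a b, node_rclt (T a) (T b) -> (a < b)%N]
  (standard lam T).
Proof.
rewrite /standard; apply: (iffP and3P) => [[/injectiveP Ti /eqP Ty /forallP To]|[Ti Ty Te To]].
  split=> // [a|u|a b ab].
  - by rewrite -Ty; apply: imset_f.
  - by rewrite -Ty => /imsetP[a _ ->]; exists a.
  - have /forallP/(_ b)/implyP := To a; apply; move: ab.
    rewrite /node_rclt /pos /trow /tcol; case: eqP => //= _.
split; first exact/injectiveP.
  apply/eqP/setP=> u; apply/imsetP/idP => [[a _ ->]//|/Te[a <-]]; by exists a.
apply/forallP=> a; apply/forallP=> b; apply/implyP=> ab; apply: To; move: ab.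
by rewrite /node_rclt /pos /trow /tcol; case: eqP.
Qed.

Section OneTableau.
Variable T : tableau d n.
Hypothesis stdT : standard lam T.

Lemma std_inj : injective T. Proof. by case/standardP: stdT. Qed.
Lemma std_young a : T a \in young n lam. Proof. by case/standardP: stdT. Qed.
Lemma std_entry u : u \in young n lam -> exists a, T a = u.
Proof. by case/standardP: stdT => _ _ + _; exact. Qed.

(* Compare both nodes with the corner (row of T a, column of T b).            *)
Lemma std_lt a b : node_le (T a) (T b) -> a != b -> (a < b)%N.
Proof.
move=> ab neq; have [_ _ _ To] := standardP _ stdT.
have [p xx yy] := node_leP _ _ ab.
have uy : ((T a).1, (T b).2) \in young n lam.
  by apply: young_le (std_young b) _; rewrite /node_le /= p eqxx xx leqnn.
have [c Tc] := std_entry uy.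
have ac : (a <= c)%N.
  have [->//|ca] := eqVneq a c; apply/ltnW/To.
  rewrite /node_rclt Tc /= !eqxx /=; apply/orP; left.
  rewrite ltn_neqAle yy andbT; apply: contra_neq ca => /val_inj e; apply: std_inj.
  by rewrite Tc -e; case: (T a).
have cb : (c <= b)%N.
  have [->//|cb] := eqVneq c b; apply/ltnW/To.
  rewrite /node_rclt Tc /= p !eqxx /=; apply/orP; right.
  rewrite ltn_neqAle xx andbT; apply: contra_neq cb => /val_inj e; apply: std_inj.
  by rewrite Tc; case: (T a) (T b) p e => [[? ?] ?] [[? ?] ?] /= -> ->.
by rewrite ltn_neqAle (leq_trans ac cb) andbT.
Qed.

(** Two nodes on one diagonal are opposite corners of a rectangle; the other two corners hold two
    different entries strictly between [a] and [b]. *)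
Lemma std_same_content a b : (T a).1.1 = (T b).1.1 ->
  ncontent (T a) = ncontent (T b) -> (a < b)%N -> (a.+2 < b)%N.
Proof.
move=> p c ab.
have nab : a != b by rewrite -val_eqE neq_ltn ab.
have leab : node_le (T a) (T b).
  have cl : (`|ncontent (T a) - ncontent (T b)|%N <= 1)%N by rewrite c subrr.
  have /orP[//|ba] := close_comparable p cl.
  by have := std_lt ba; rewrite eq_sym nab => /(_ isT); lia.
have [_ xx yy] := node_leP _ _ leab.
have xlt : (T a).1.2 != (T b).1.2 :> nat.
  apply: contra_neq nab => e; apply: std_inj.
  case: (T a) (T b) p c e => [[k x] y] [[k' x'] y'] /= -> + e.
  rewrite /ncontent /= e => c; congr (_, _, _); apply: val_inj => //=; lia.
have ylt : (T a).2 != (T b).2 :> nat by move: c xlt; rewrite /ncontent; lia.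
have u1y : ((T a).1, (T b).2) \in young n lam.
  by apply: young_le (std_young b) _; rewrite /node_le /= p eqxx xx leqnn.
have u2y : ((T b).1, (T a).2) \in young n lam.
  by apply: young_le (std_young b) _; rewrite /node_le /= eqxx leqnn yy.
have [[e1 T1] [e2 T2]] := (std_entry u1y, std_entry u2y).
have e12 : e1 != e2.
  apply: contraNneq xlt => e; move: T1; rewrite e T2.
  by move/(congr1 (fun v : node d n => v.1)) => /= ->.
have ne1a : a != e1 by apply: contraNneq ylt => ->; rewrite T1.
have ne2a : a != e2 by apply: contraNneq xlt => ->; rewrite T2.
have ne1b : e1 != b by apply: contraNneq xlt => <-; rewrite T1.
have ne2b : e2 != b by apply: contraNneq ylt => <-; rewrite T2.
have := std_lt _ ne1a; have := std_lt _ ne2a.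
have := std_lt _ ne1b; have := std_lt _ ne2b.
rewrite T1 T2 /node_le /= p !eqxx xx yy !leqnn /=.
by move=> /(_ isT) + /(_ isT) + /(_ isT) + /(_ isT); move: e12; rewrite -val_eqE /=; lia.
Qed.

(** No entry lies between consecutive [a] and [b], so the neighbour [u] of [T a] in the direction of
    [T b] must be [T b] itself. *)
Lemma std_rclt_content (a b : 'I_n) : b = a.+1 :> nat -> node_rclt (T a) (T b) ->
  `|ncontent (T a) - ncontent (T b)|%N = 1%N.
Proof.
move=> ba rab; have /andP[leab _] := node_rclt_le rab.
have [p xx yy] := node_leP _ _ leab.
have between u : u \in young n lam -> node_le (T a) u -> node_le u (T b) ->
    u = T a \/ u = T b.
  move=> /std_entry[c <-] ac cb.
  have [->|nac] := eqVneq a c; first by left.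
  have [->|ncb] := eqVneq c b; first by right.
  by have := std_lt ac nac; have := std_lt cb ncb; lia.
case/andP: rab => _ /orP[] /andP[/eqP e lt].
- have yn : ((T a).2.+1 < n)%N by apply: leq_ltn_trans lt (ltn_ord _).
  pose u : node d n := ((T a).1, Ordinal yn).
  have ub : node_le u (T b) by rewrite /node_le /= p eqxx xx.
  have au : node_le (T a) u by rewrite /node_le /= eqxx leqnn leqnSn.
  have [E|E] := between u (young_le (std_young b) ub) au ub.
    by move: (congr1 (fun v => val v.2) E) => /=; lia.
  by move: (congr1 (fun v => val v.2) E) => /=; rewrite /ncontent e; lia.
- have xn : ((T a).1.2.+1 < n)%N by apply: leq_ltn_trans lt (ltn_ord _).
  pose u : node d n := ((T a).1.1, Ordinal xn, (T a).2).
  have ub : node_le u (T b) by rewrite /node_le /= p eqxx yy lt.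
  have au : node_le (T a) u by rewrite /node_le /= eqxx leqnn leqnSn.
  have [E|E] := between u (young_le (std_young b) ub) au ub.
    by move: (congr1 (fun v => val v.1.2) E) => /=; lia.
  by move: (congr1 (fun v => val v.1.2) E) => /=; rewrite /ncontent e; lia.
Qed.

Lemma std_swap i : ~~ node_rclt (T (lo i)) (T (hi i)) ->
  standard lam (tab_perm T (sgen i)).
Proof.
move=> nrc; apply/standardP; split.
- by move=> a b; rewrite !tab_swapE => /std_inj/perm_inj.
- by move=> a; rewrite tab_swapE std_young.
- by move=> u /std_entry[a <-]; exists (sgen i a); rewrite tab_swapE tpermK.
move=> a b; rewrite !tab_swapE => rc; rewrite -[a](tpermK (lo i) (hi i)).
rewrite -[b](tpermK (lo i) (hi i)) -!/(sgen i).
have /andP[le ne] := node_rclt_le rc.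
apply: sgen_lt; last by apply: std_lt le _; apply: contraNneq ne => ->.
by apply: contra nrc => /andP[/eqP <- /eqP <-].
Qed.

End OneTableau.

(** Nodes with contents at distance at most 1 are comparable, which forces the order of their
    entries; the exchange would then break standardness. *)
Lemma std_swap_content T i : standard lam T -> standard lam (tab_perm T (sgen i)) ->
  (T (lo i)).1.1 = (T (hi i)).1.1 ->
  (1 < `|ncontent (T (lo i)) - ncontent (T (hi i))|)%N.
Proof.
move=> stdT stdTs p; rewrite ltnNge; apply/negP => /(close_comparable p)/orP[le|le].
  have := std_lt stdTs (a := hi i) (b := lo i); rewrite tab_swap_lo tab_swap_hi.
  by move=> /(_ le); rewrite eq_sym lo_neq_hi => /(_ isT) /=; lia.
by have := std_lt stdT le; rewrite eq_sym lo_neq_hi => /(_ isT) /=; lia.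
Qed.

Lemma std_first T (a : 'I_n) : standard lam T -> a = 0%N :> nat ->
  (T a).1.2 = 0%N :> nat /\ (T a).2 = 0%N :> nat.
Proof.
move=> sT a0; have n0 : (0 < n)%N by rewrite -a0.
pose u : node d n := ((T a).1.1, Ordinal n0, Ordinal n0).
have ua : node_le u (T a) by rewrite /node_le /= eqxx.
have [e Te] := std_entry sT (young_le (std_young sT a) ua).
have [ea|ne] := eqVneq e a; first by rewrite -ea Te.
by rewrite -Te in ua; have := std_lt sT ua ne; rewrite a0.
Qed.

(** Outside the first row and the first column, the node at the top of the column of [T b] would
    hold a smaller entry different from [a]. *)
Lemma std_second T (a b : 'I_n) : standard lam T -> a = 0%N :> nat ->
  b = 1%N :> nat -> (T a).1.1 = (T b).1.1 -> node_rclt (T a) (T b).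
Proof.
move=> sT a0 b1 p; have [x0 y0] := std_first sT a0.
have nab : a != b by rewrite -val_eqE /= a0 b1.
rewrite /node_rclt p eqxx -!val_eqE /= x0 y0.
have [x1|x1] := posnP (T b).1.2; have [y1|y1] := posnP (T b).2.
- case/eqP: nab; apply: (std_inj sT).
  case: (T a) (T b) p x0 y0 x1 y1 => [[k x] y] [[k' x'] y'] /= -> x0 y0 x1 y1.
  by congr (_, _, _); apply: val_inj; rewrite /= ?x0 ?y0 ?x1 ?y1.
- by rewrite x1.
- by rewrite y1 orbC.
have n0 : (0 < n)%N by rewrite -a0.
pose u : node d n := ((T b).1.1, Ordinal n0, (T b).2).
have ub : node_le u (T b) by rewrite /node_le /= eqxx leqnn.
have [e Te] := std_entry sT (young_le (std_young sT b) ub).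
have nea : e != a by apply: contraTneq y1 => ea; rewrite -leqNgt -y0 -ea Te leqnn.
have neb : e != b by apply: contraTneq x1 => eb; rewrite -leqNgt -eb Te.
rewrite -Te in ub; have := std_lt sT ub neb.
by move: nea; rewrite -val_eqE /=; lia.
Qed.

(** Both nodes of the first row are taken, so [c] is in a lower row; the node just below the corner
    precedes [T c], and only [c] is left to fill it. *)
Lemma std_third T (a b c : 'I_n) : standard lam T -> a = 0%N :> nat ->
    b = 1%N :> nat -> c = 2%N :> nat ->
    (T a).1.1 = (T b).1.1 -> (T b).1.1 = (T c).1.1 ->
    (ncolumns (lam (T a).1.1) <= 2)%N -> ncontent (T b) = 1%R ->
  ncontent (T c) = (-1)%R.
Proof.
move=> sT a0 b1 c2 pab pbc col c1; have [x0 y0] := std_first sT a0.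
have := std_second sT a0 b1 pab; rewrite /node_rclt -!val_eqE /= x0 y0 => rc.
have [xb yb] : (T b).1.2 = 0%N :> nat /\ (T b).2 = 1%N :> nat.
  by move: c1 rc; rewrite /ncontent; lia.
have yc : ((T c).2 < 2)%N.
  have := std_young sT c; rewrite inE => /leq_trans; apply.
  by apply: leq_trans (part_nth _ (leq0n _)) _; rewrite -pbc -pab nth0.
have xc : (0 < (T c).1.2)%N.
  rewrite lt0n; apply/eqP => xc.
  have eqT (e : 'I_n) : (T e).1.1 = (T c).1.1 -> (T e).1.2 = (T c).1.2 :> nat ->
      (T e).2 = (T c).2 :> nat -> e = c.
    move=> p x y; apply: (std_inj sT).
    case: (T e) (T c) p x y => [[? ?] ?] [[? ?] ?] /= -> x y.
    by congr (_, _, _); apply: val_inj.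
  have [y|y] : (T c).2 = 0%N :> nat \/ (T c).2 = 1%N :> nat by lia.
    have := eqT a; rewrite x0 y0 xc y pab pbc => /(_ erefl erefl erefl) e.
    by rewrite e c2 in a0.
  have := eqT b; rewrite xb yb xc y pbc => /(_ erefl erefl erefl) e.
  by rewrite e c2 in b1.
have n1 : (1 < n)%N by rewrite -b1.
pose u : node d n := ((T c).1.1, Ordinal n1, Ordinal (ltnW n1)).
have uc : node_le u (T c) by rewrite /node_le /= eqxx xc.
have [e Te] := std_entry sT (young_le (std_young sT c) uc).
have nea : e != a by apply/eqP => ea; move: x0; rewrite -ea Te.
have neb : e != b by apply/eqP => eb; move: xb; rewrite -eb Te.
have [ec|nec] := eqVneq e c; first by rewrite -ec Te /ncontent.
rewrite -Te in uc; have := std_lt sT uc nec.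
by move: nea neb; rewrite -!val_eqE /=; lia.
Qed.

End Standard.

(** * Rigidity and connectedness of the set of standard tableaux *)

Lemma ord_homo_ge n (f : 'I_n -> nat) :
  {homo f : a b / (a < b)%N} -> forall a : 'I_n, (a <= f a)%N.
Proof.
move=> fM [m mn]; elim: m mn => [//|m IH] mn /=.
apply: leq_ltn_trans (IH (ltnW mn)) _; exact: fM.
Qed.

Lemma ord_homo_id n (f : 'I_n -> 'I_n) : {homo f : a b / (a < b)%N} -> f =1 id.
Proof.
move=> fM a; apply/val_inj/eqP; rewrite eqn_leq /= (ord_homo_ge (f := f)) // andbT.
(* The upper bound on [f a] is the lower bound for the conjugate of [f] by the order reversal. *)
have gM : {homo (fun b => n.-1 - f (rev_ord b))%N : x y / (x < y)%N}.
  move=> x y xy /=; have := fM (rev_ord y) (rev_ord x); rewrite /=.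
  by have := ltn_ord (f (rev_ord x)); have := ltn_ord y; lia.
have := ord_homo_ge gM (rev_ord a); rewrite rev_ordK /=.
by have := ltn_ord (f a); have := ltn_ord a; lia.
Qed.

Section Standard.
Variables (d n : nat) (lam : 'I_d -> seq nat).
Hypothesis hlam : is_dpartition n lam.
Implicit Types (T : tableau d n).

(** At the first entry [a] where they differ, the two nodes have equal content and are comparable.
    The smaller one carries, in the other tableau, an entry before [a], where both tableaux agree;
    this contradicts injectivity. *)
Lemma std_determined T T' : standard lam T -> standard lam T' ->
    (forall a, (T a).1.1 = (T' a).1.1) ->
    (forall a, ncontent (T a) = ncontent (T' a)) -> T = T'.
Proof.
move=> sT sT' pE cE.
suff E m : forall a : 'I_n, (a < m)%N -> T a = T' a.
  apply/ffunP => a; apply: (E n); apply: ltn_ord.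
elim: m => [//|m IH] a; rewrite ltnS => am; apply/eqP/negPn/negP => neq.
have cl : (`|ncontent (T a) - ncontent (T' a)| <= 1)%N by rewrite cE subrr.
have /orP[le|le] := close_comparable (pE a) cl.
- have [e Te] := std_entry sT' (std_young sT a).
  have nea : e != a by apply: contraNneq neq => ea; rewrite -Te ea.
  rewrite -Te in le; have ea := std_lt hlam sT' le nea.
  have := IH e (leq_trans ea am); rewrite Te => /(std_inj sT) e'.
  by rewrite e' eqxx in nea.
- have [e Te] := std_entry sT (std_young sT' a).
  have nea : e != a by apply: contraNneq neq => ea; rewrite -Te ea.
  rewrite -Te in le; have ea := std_lt hlam sT le nea.
  have := IH e (leq_trans ea am); rewrite Te => /esym/(std_inj sT') e'.
  by rewrite e' eqxx in nea.
Qed.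

(* Sorting T into T0 by adjacent transpositions: each one removes a descent   *)
(* of the permutation w with T = T0 \o w, so it increases \sum_a a * w a.     *)
Lemma std_connected (P : tableau d n -> Prop) T T0 :
    (forall i S, standard lam S -> standard lam (tab_perm S (sgen i)) ->
       P S -> P (tab_perm S (sgen i))) ->
  standard lam T -> standard lam T0 -> P T -> P T0.
Proof.
move=> Pswap + sT0.
pose w (S : tableau d n) (a : 'I_n) : 'I_n := odflt a [pick b | T0 b == S a].
have wE S a : standard lam S -> T0 (w S a) = S a.
  move=> sS; rewrite /w; case: pickP => [b /eqP//|no].
  have [b Tb] := std_entry sT0 (std_young sS a).
  by have := no b; rewrite Tb eqxx.
pose mu S := (\sum_(a < n) a * w S a)%N.
have mu_le S : (mu S <= n * (n * n))%N.
  rewrite /mu -[n in (n * _)%N]card_ord -sum_nat_const leq_sum // => a _.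
  by rewrite leq_mul // ltnW.
have [m] := ubnP (n * (n * n) - mu T)%N.
elim: m T => [//|m IH] T mT sT PT.
have [/forallP asc|] := boolP [forall i, (w T (lo i) < w T (hi i))%N].
  have wM : {homo w T : a b / (a < b)%N}.
    move=> a [b bn] /=; elim: b bn => [//|b IHb] bn; rewrite ltnS => ab.
    have bn' : (b < n.-1)%N by lia.
    have := asc (Ordinal bn').
    rewrite (_ : hi _ = Ordinal bn); last exact: val_inj.
    apply: leq_trans; rewrite ltnS.
    have := ab; rewrite leq_eqVlt => /predU1P[e|ab'].
      by rewrite (_ : a = lo (Ordinal bn')) //; apply: val_inj.
    have bn2 : (b < n)%N by lia.
    rewrite (_ : lo _ = Ordinal bn2); last exact: val_inj.
    exact/ltnW/IHb.
  suff <- : T = T0 by [].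
  by apply/ffunP => a; rewrite -(wE T a) // (ord_homo_id wM).
rewrite negb_forall => /existsP[i]; rewrite -leqNgt => desc.
have {}desc : (w T (hi i) < w T (lo i))%N.
  rewrite ltn_neqAle desc andbT; apply/eqP => /val_inj e.
  have := wE T (hi i) sT; rewrite e wE // => /(std_inj sT)/eqP.
  by rewrite (negPf (lo_neq_hi i)).
have sTs : standard lam (tab_perm T (sgen i)).
  apply: std_swap => //; apply: contraL desc; rewrite -!(wE T) // => rc.
  rewrite -leqNgt ltnW //; have /andP[le ne] := node_rclt_le rc.
  by apply: (std_lt hlam sT0 le); apply: contraNneq ne => ->.
have ws a : w (tab_perm T (sgen i)) a = w T (sgen i a).
  by apply: (std_inj sT0); rewrite !wE // tab_swapE.
apply: IH (Pswap _ _ sT sTs PT) => //.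
suff : (mu T < mu (tab_perm T (sgen i)))%N.
  by have := mu_le (tab_perm T (sgen i)); lia.
have split S : mu S = (lo i * w S (lo i) + (hi i * w S (hi i) +
    \sum_(a < n | (a != lo i) && (a != hi i)) a * w S a))%N.
  by rewrite /mu (bigD1 (lo i)) // (bigD1 (hi i)) // eq_sym lo_neq_hi.
rewrite !split !ws sgenL sgenR.
have -> : (\sum_(a < n | (a != lo i) && (a != hi i)) a * w (tab_perm T (sgen i)) a =
    \sum_(a < n | (a != lo i) && (a != hi i)) a * w T a)%N.
  by apply: eq_bigr => a /andP[al ah]; rewrite ws sgenD.
rewrite addnA [ltnRHS]addnA ltn_add2r /=.
by move: desc; move: (w T (lo i)) (w T (hi i)) => [x xn] [y yn] /=; nia.
Qed.

(** * Counting nodes and filling the diagrams row by row *)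

Lemma sumn_nth_ord s m : (size s <= m)%N -> sumn s = (\sum_(x < m) nth 0 s x)%N.
Proof.
move=> sm; rewrite sumnE (big_nth 0) big_mkord.
rewrite (big_ord_widen _ (fun i => nth 0 s i) sm) big_mkcond /=; apply: eq_bigr => x _.
by case: ltnP => // sx; rewrite nth_default.
Qed.

Lemma sumn_le k : (sumn (lam k) <= n)%N.
Proof. by rewrite -hlam.2 (bigD1 k) //= leq_addr. Qed.

Lemma part_size k : (size (lam k) <= n)%N.
Proof.
apply: leq_trans (sumn_le k); have /andP[_] := hlam.1 k.
elim: (lam k) => //= x s IH; rewrite inE negb_or eq_sym => /andP[x0 /IH].
by move: x0; case: x => //= x _; lia.
Qed.

Lemma part_nth_le k x : (nth 0 (lam k) x <= n)%N.
Proof.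
apply: leq_trans (sumn_le k); elim: (lam k) x => [|y s IH] [|x] //=.
  exact: leq_addr.
by apply: leq_trans (IH x) (leq_addl _ _).
Qed.

Lemma card_young : #|young n lam| = n.
Proof.
rewrite -sum1_card big_mkcond /=.
pose F (k : 'I_d) (x y : 'I_n) : nat := (y < nth 0 (lam k) x)%N.
transitivity (\sum_(u : node d n) F u.1.1 u.1.2 u.2)%N.
  by apply: eq_bigr => u _; rewrite inE /F; case: ltnP.
rewrite -(pair_bigA _ (fun (kx : 'I_d * 'I_n) y => F kx.1 kx.2 y)) /=.
rewrite -(pair_bigA _ (fun k x => \sum_y F k x y)%N) /= -[RHS]hlam.2.
apply: eq_bigr => k _; rewrite (sumn_nth_ord (part_size k)); apply: eq_bigr => x _.
rewrite /F; have := part_nth_le k x; move: (nth 0 (lam k) x) => m mn.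
rewrite -[RHS]muln1 -[m in RHS]card_ord -sum_nat_const.
rewrite (big_ord_widen _ (fun=> 1%N) mn) [RHS]big_mkcond /=.
by apply: eq_bigr => y _; case: ltnP.
Qed.

(** Reading the nodes row by row, diagram [k0] first, gives a standard tableau. It shows that
    V_lambda is nonzero, and for a diagram with three columns it puts the first three entries in a
    row. *)
Lemma std_exists (k0 : 'I_d) : exists T, standard lam T /\
  forall y : 'I_n, (y < ncolumns (lam k0))%N ->
    [/\ (T y).1.1 = k0, (T y).1.2 = 0%N :> nat & (T y).2 = y].
Proof.
(* Lexicographic order written in base [n]; the leading digit is 0 for diagram [k0] and positive for
   all others. *)
pose key (u : node d n) := ((((u.1.1 != k0) * u.1.1.+1) * n + u.1.2) * n + u.2)%N.
have key_rc u v : node_rclt u v -> (key u < key v)%N.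
  case: u v => [[k x] y] [[k' x'] y'] /andP[/= /eqP-> H]; rewrite /key /=.
  move: (((k' != k0) * _) * n)%N => c.
  have := ltn_ord y; have := ltn_ord y'.
  by move: H; rewrite -!val_eqE /=; nia.
have key_inj : injective key.
  move=> [[k x] y] [[k' x'] y'] /=; rewrite /key /= => E.
  have [yn yn'] := (ltn_ord y, ltn_ord y').
  have [xn xn'] := (ltn_ord x, ltn_ord x').
  have yy : y = y' by apply: val_inj; move: (congr1 (modn^~ n) E); rewrite !modnMDl !modn_small.
  have E1 : ((k != k0) * k.+1 * n + x = (k' != k0) * k'.+1 * n + x')%N.
    by move: (congr1 (divn^~ n) E); rewrite !divnMDl ?divn_small ?addn0 //; lia.
  have xx : x = x' by apply: val_inj; move: (congr1 (modn^~ n) E1); rewrite !modnMDl !modn_small.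
  have E2 : ((k != k0) * k.+1 = (k' != k0) * k'.+1)%N.
    by move: (congr1 (divn^~ n) E1); rewrite !divnMDl ?divn_small ?addn0 //; lia.
  congr (_, _, _) => //; move: E2.
  case: (eqVneq k k0) => [->|_]; case: (eqVneq k' k0) => [->|_] //=.
  by rewrite !mul1n => -[/val_inj].
pose s := sort (relpre key leq) (enum (young n lam)).
have szs : size s == n by rewrite size_sort -cardE card_young.
pose t := Tuple szs; pose T : tableau d n := [ffun a => tnth t a].
have TE a : T a = tnth t a by rewrite ffunE.
have Tinj : injective T.
  move=> a b; rewrite !TE; apply/tuple_uniqP.
  by rewrite /= sort_uniq enum_uniq.
have Tmem u : (u \in young n lam) = (u \in t) by rewrite /= mem_sort mem_enum.
have Tle (a b : 'I_n) : (a <= b)%N -> (key (T a) <= key (T b))%N.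
  move=> ab; rewrite !TE !(tnth_nth (T a)) /=.
  have tr : transitive (relpre key leq) by move=> ? ? ? /=; apply: leq_trans.
  have rf : reflexive (relpre key leq) by move=> ? /=.
  apply: (sorted_leq_nth tr rf) => //; rewrite ?inE ?(eqP szs) //.
  by apply: sort_sorted => u v /=; apply: leq_total.
have Tlt (a b : 'I_n) : (a < b)%N -> (key (T a) < key (T b))%N.
  move=> ab; rewrite ltn_neqAle Tle ?(ltnW ab) // andbT.
  apply: contraTneq ab => /key_inj/Tinj->; by rewrite ltnn.
have sT : standard lam T.
  apply/standardP; split=> // [a|u|a b /key_rc].
  - by rewrite Tmem TE mem_tnth.
  - by rewrite Tmem => /tnthP[a ->]; exists a.
  - by rewrite !ltnNge; apply: contra => /Tle.
exists T; split=> // -[y yn] /= yc.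
have n0 : (0 < n)%N by lia.
suff -> : T (Ordinal yn) = (k0, Ordinal n0, Ordinal yn) by [].
have mem z (zn : (z < n)%N) : (z <= y)%N ->
    ((k0, Ordinal n0, Ordinal zn) : node d n) \in young n lam.
  by move=> zy; rewrite inE /= nth0 (leq_ltn_trans zy).
have [b Tb] := std_entry sT (mem y yn (leqnn y)).
suff e : b = Ordinal yn by move: Tb; rewrite e.
(* Keys increase strictly with the entries, so [b] is at most its key [y]; conversely, entries
   increase strictly along the first row, so [b] is at least [y]. *)
apply: val_inj => /=; apply/eqP; rewrite eqn_leq; apply/andP; split.
  have := ord_homo_ge Tlt b; rewrite Tb /key /= eqxx; lia.
elim: y yn yc b mem Tb => [//|y IH] yn yc b mem Tb.
have yn' := ltnW yn.
have [c Tc] := std_entry sT (mem y yn' (leqnSn y)).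
apply: leq_ltn_trans (IH yn' (ltnW yc) c _ Tc) _.
  by move=> z zn zy; apply: mem; lia.
by case/standardP: sT => _ _ _; apply; rewrite Tc Tb /node_rclt /= !eqxx ltnSn.
Qed.

End Standard.

Local Open Scope ring_scope.

(** * Universal properties *)

Section Lifting.
Variables (K : comNzRingType) (B : nzRingType) (s : {rmorphism K -> B}).
Hypothesis s_central : forall c b, s c * b = b * s c.

(** A word goes to the product of the images of its letters; centrality of the scalars makes the
    linear extension multiplicative. *)
Lemma freeAlg_lift (X : choiceType) (f : X -> B) :
  exists h : {rmorphism freeAlg K X -> B},
    (forall c, h (scal c) = s c) /\ (forall x, h (free_gen K x) = f x).
Proof.
pose e (m : {fmonom X}) := \prod_(x <- fmonom_val m) f x.
have eM : mmorphism e.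
  split=> [x y|]; first by rewrite /e fmM big_cat.
  by rewrite /e fm1 big_nil.
pose em : {mmorphism {fmonom X} -> B} := HB.pack e (isMultiplicative.Build _ _ e eM).
have hM := @commr_mmap_is_multiplicative _ _ _ s em
  (fun g m m' => s_central g@_m (em m')).
pose h : {malg K[{fmonom X}]} -> B := mmap s em.
pose hA := GRing.isAdditive.Build _ _ h (@mmap_is_additive _ _ _ s em).
pose hMm := GRing.isMultiplicative.Build _ _ h hM.
pose hr : {rmorphism freeAlg K X -> B} := HB.pack (h : freeAlg K X -> B) hA hMm.
exists hr; split=> [c|x].
  have -> : hr (scal c) = h (c *: 1) by [].
  by rewrite /h mmapZ (rmorph1 hr) mulr1.
have -> : hr (free_gen K x) = h << fmu x >> by [].
by rewrite /h mmapU /= rmorph1 mul1r /e fmU big_seq1.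
Qed.

Lemma quotAlg_lift (A : assocAlgType K) (S : A -> Prop) (f : {rmorphism A -> B}) :
    (forall c, f (scal c) = s c) -> (forall x, S x -> f x = 0) ->
  exists h : {rmorphism quotAlg A S -> B},
    (forall c, h (scal c) = s c) /\ (forall x, h (quot_pi S x) = f x).
Proof.
move=> fs fS.
have fI x : ideal_gen S x -> f x = 0.
  elim=> {x}[x /fS //||x y _ fx _ fy|a x _ fx|x a _ fx].
  - exact: rmorph0.
  - by rewrite rmorphD fx fy addr0.
  - by rewrite rmorphM fx mulr0.
  - by rewrite rmorphM fx mul0r.
pose h (x : quotAlg A S) := f (repr x).
have hE x : h (quot_pi S x) = f x.
  by apply/eqP; rewrite -subr_eq0 -rmorphB fI //; apply: repr_quot_pi.
have hA : additive h.
  move=> x y; rewrite -(quot_piK x) -(quot_piK y) !hE -rmorphB -hE.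
  congr (h _); rewrite -[in LHS](subrK (repr y) (repr x)) quot_piD.
  by rewrite addrK.
have hM : multiplicative h.
  split=> [x y|]; last by rewrite -quot_pi1 hE rmorph1.
  by rewrite -(quot_piK x) -(quot_piK y) -quot_piM !hE rmorphM.
pose hr : {rmorphism quotAlg A S -> B} := HB.pack h
  (GRing.isAdditive.Build _ _ h hA) (GRing.isMultiplicative.Build _ _ h hM).
by exists hr; split=> [c|//]; rewrite -fs -hE.
Qed.

Lemma presented_lift (X : choiceType) (f : X -> B) rel
    (h0 : {rmorphism freeAlg K X -> B}) :
    (forall c, h0 (scal c) = s c) -> (forall x, h0 (free_gen K x) = f x) ->
    (forall x y, rel x y -> h0 x = h0 y) ->
  exists h : {rmorphism presented rel -> B},
    (forall c, h (scal c) = s c) /\ (forall x, h (presented_gen rel x) = f x).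
Proof.
move=> h0s h0f h0r.
have [x [a [b [/h0r ab ->]]]|h [hs hE]] := quotAlg_lift (S := relators rel) h0s.
  by rewrite rmorphB ab subrr.
by exists h; split=> // x; rewrite hE h0f.
Qed.

End Lifting.

Lemma scalarExt_lift (k K : comNzRingType) (phi : {rmorphism k -> K})
    (A : assocAlgType k) (B : nzRingType) (s : {rmorphism K -> B})
    (h : {rmorphism A -> B}) :
    (forall c b, s c * b = b * s c) -> (forall c, h (scal c) = s (phi c)) ->
  exists g : {rmorphism scalarExt phi A -> B},
    (forall c, g (scal c) = s c) /\ (forall x, g (ext_in phi x) = h x).
Proof.
move=> sC hs; have [h0 [h0s h0f]] := freeAlg_lift sC h.
apply: (presented_lift h0s h0f) => x y [|a b|a b|c a].
- by rewrite h0f !rmorph1.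
- by rewrite rmorphD !h0f rmorphD.
- by rewrite rmorphM !h0f rmorphM.
- by rewrite rmorphM !h0f rmorphM hs h0s.
Qed.

Section ExtIn.
Variables (k K : comNzRingType) (phi : {rmorphism k -> K}) (A : assocAlgType k).

Lemma presented_rel (X : choiceType) (rel : freeAlg K X -> freeAlg K X -> Prop) x y :
  rel x y -> quot_pi (relators rel) x = quot_pi (relators rel) y.
Proof. by move=> xy; apply/eqP/quot_piP/IdealGen; exists x, y. Qed.

Lemma ext_in1 : ext_in phi (1 : A) = 1.
Proof. exact: (presented_rel (ExtRel1 phi A)). Qed.

Lemma ext_inD (x y : A) : ext_in phi (x + y) = ext_in phi x + ext_in phi y.
Proof. by rewrite -quot_piD; exact: (presented_rel (ExtRelD phi x y)). Qed.

Lemma ext_inM (x y : A) : ext_in phi (x * y) = ext_in phi x * ext_in phi y.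
Proof. by rewrite -quot_piM; exact: (presented_rel (ExtRelM phi x y)). Qed.

Lemma ext_in0 : ext_in phi (0 : A) = 0.
Proof. by apply: (addrI (ext_in phi 0)); rewrite -ext_inD !addr0. Qed.

Lemma ext_in_scal c : ext_in phi (scal c : A) = scal (phi c).
Proof.
rewrite -[scal c]mulr1.
rewrite [LHS](presented_rel (ExtRelZ phi c 1)).
by rewrite quot_piM [X in _ * X]ext_in1 mulr1.
Qed.

End ExtIn.

(** * The coefficients of the seminormal form *)

Section Seminormal.
Variables (F : fieldType) (q : F).
Definition snA (u v : F) := (q * v - v) / (v - u).
Definition snB (u v : F) := (q * v - u) / (v - u).

(** The trace of the 2 by 2 block of [g_i] on a tableau and its exchange, whose eigenvalues are q
    and -1. *)
Lemma snA_add u v : u != v -> snA u v + snA v u = q - 1.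
Proof.
move=> uv; rewrite /snA; field.
by rewrite !subr_eq0 uv eq_sym uv.
Qed.

(** The same block has determinant -q. *)
Lemma snB_mul u v : u != v -> snB u v * snB v u = q + snA u v * snA v u.
Proof.
move=> uv; rewrite /snA /snB; field.
by rewrite !subr_eq0 uv eq_sym uv.
Qed.

Lemma snA_cross u v : snA u v * u + snA v u * v = 0.
Proof.
have [->|uv] := eqVneq u v; first by rewrite /snA subrr invr0 !mulr0 !mul0r addr0.
by rewrite /snA; field; rewrite !subr_eq0 uv eq_sym uv.
Qed.

Lemma snA_braid_l u v w : u != v -> u != w -> v != w ->
  snA u v * snA v w + snA u w * snA v u = snA v w * snA u w.
Proof.
move=> uv uw vw; rewrite /snA; field.
by rewrite !subr_eq0 ?uv ?uw ?vw ?(eq_sym v) ?(eq_sym w) ?uv ?uw ?vw.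
Qed.

Lemma snA_braid_r u v w : u != v -> u != w -> v != w ->
  snA u v * snA u w = snA v w * snA u v + snA u w * snA w v.
Proof.
move=> uv uw vw; rewrite /snA; field.
by rewrite !subr_eq0 ?uv ?uw ?vw ?(eq_sym v) ?(eq_sym w) ?uv ?uw ?vw.
Qed.

Lemma snA_right u : u != 0 -> q != 1 -> snA u (q * u) = q.
Proof. by move=> u0 q1; rewrite /snA; field; rewrite -mulN1r -mulrDl mulf_neq0 // subr_eq0. Qed.

Lemma snA_down u : u != 0 -> q != 0 -> q != 1 -> snA u (q^-1 * u) = -1.
Proof.
move=> u0 q0 q1; rewrite /snA; field.
rewrite q0 /=; have -> : u + - u * q = u * (1 - q) by ring.
by rewrite mulf_neq0 // subr_eq0 eq_sym.
Qed.

(** Here q and q^-1 are the contents of the second and third entries of a hook; the coefficient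
    equals -1/(1+q). *)
Lemma snA_hook : q != 0 -> q ^+ 2 != 1 -> 1 + snA q q^-1 + q * snA q q^-1 = 0.
Proof.
move=> q0 q2; rewrite /snA; field.
by rewrite q0 mulNr -expr2 subr_eq0 eq_sym.
Qed.

End Seminormal.

(** * Vector identities behind the relations *)

Section SixTerm.
Variables (F : fieldType) (I : finType).
Local Notation V := {ffun I -> F^o}.

Lemma ffun_addE (x y : V) i : (x + y) i = x i + y i :> F.
Proof. by rewrite ffunE. Qed.
Lemma ffun_scaleE (c : F) (x : V) i : (c *: x) i = c * x i :> F.
Proof. by rewrite ffunE. Qed.

(** The six vectors are the orbit of a tableau under permutations of three consecutive entries.
    Indices 1, 2, 3 name the nodes of these entries in [x]; [a] and [b] with indices r and s are the
    diagonal and exchange coefficients when node r precedes node s. *)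
Lemma braid_six (f1 f2 : V -> V)
    (x y1 y2 z12 z21 w : V) (a12 a21 a13 a23 a32 b12 b21 b13 b23 b32 q : F) :
  linear f1 -> linear f2 ->
  f1 x = a12 *: x + b12 *: y1 -> f2 x = a23 *: x + b23 *: y2 ->
  f1 y1 = a21 *: y1 + b21 *: x -> f2 y2 = a32 *: y2 + b32 *: x ->
  f2 y1 = a13 *: y1 + b13 *: z12 -> f1 y2 = a13 *: y2 + b13 *: z21 ->
  f1 z12 = a23 *: z12 + b23 *: w -> f2 z21 = a12 *: z21 + b12 *: w ->
  b12 * b21 = q + a12 * a21 -> b23 * b32 = q + a23 * a32 ->
  a12 * a23 + a13 * a21 = a23 * a13 -> a12 * a13 = a23 * a12 + a13 * a32 ->
  f1 (f2 (f1 x)) = f2 (f1 (f2 x)).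
Proof.
move=> f1L f2L.
pose F1 : {linear V -> V} := HB.pack f1 (GRing.isLinear.Build _ _ _ _ f1 f1L).
pose F2 : {linear V -> V} := HB.pack f2 (GRing.isLinear.Build _ _ _ _ f2 f2L).
rewrite -[f1]/(F1 : _ -> _) -[f2]/(F2 : _ -> _).
move: F1 F2 => {f1L f2L} {}f1 {}f2.
move=> f1x f2x f1y f2y f2y1 f1y2 f1z f2z m12 m23 e2 e3.
rewrite f1x f2x !(linearD, linearZ) /= f2x f2y1 f1x f1y2 !(linearD, linearZ) /=.
rewrite f1x f1y f1y2 f1z f2x f2y f2y1 f2z.
apply/ffunP => i; rewrite !(ffun_addE, ffun_scaleE).
move: (x i : F) (y1 i : F) (y2 i : F) (z12 i : F) (z21 i : F) (w i : F).
move=> X Y1 Y2 Z12 Z21 W.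
(* The coordinates of [z12], [z21] and [w] cancel identically; those of [x], [y1] and [y2] are
   combinations of the four assumed identities. *)
apply: subr0_eq; transitivity
  (X * (a13 * (b12 * b21 - (q + a12 * a21)) - a13 * (b23 * b32 - (q + a23 * a32))
        + a12 * (a12 * a23 + a13 * a21 - a23 * a13)
        + a23 * (a12 * a13 - (a23 * a12 + a13 * a32)))
   + Y1 * b12 * (a12 * a23 + a13 * a21 - a23 * a13)
   + Y2 * b23 * (a12 * a13 - (a23 * a12 + a13 * a32))); first by ring.
by rewrite m12 m23 e2 e3 !(subrr, mulr0, addr0).
Qed.
(** Cayley-Hamilton for a block of trace [a + a'] and determinant [-q]. *)
Lemma quad_two (x x' : V) (a a' b b' q : F) : b * b' = q + a * a' ->
  a *: (a *: x + b *: x') + b *: (a' *: x' + b' *: x) =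
  q *: x + (a + a') *: (a *: x + b *: x').
Proof.
move=> m; apply/ffunP => i; rewrite !(ffun_addE, ffun_scaleE).
move: (x i : F) (x' i : F) => X X'.
apply: subr0_eq; transitivity (X * (b * b' - (q + a * a'))); first by ring.
by rewrite m subrr mulr0.
Qed.

(** If M is diagonal with eigenvalues [c] and [c'] on [x] and [x'], then g M g has eigenvalue
    [q * c'] on [x]; the second hypothesis removes the [x'] term. *)
Lemma murphy_two (x x' : V) (a a' b b' q c c' : F) :
  b * b' = q + a * a' -> a * c + a' * c' = 0 ->
  (a * c) *: (a *: x + b *: x') + (b * c') *: (a' *: x' + b' *: x) = (q * c') *: x.
Proof.
move=> m z; apply/ffunP => i; rewrite !(ffun_addE, ffun_scaleE).
move: (x i : F) (x' i : F) => X X'.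
apply: subr0_eq; transitivity
  (X * c' * (b * b' - (q + a * a')) + (X * a + X' * b) * (a * c + a' * c')); first by ring.
by rewrite m z subrr !mulr0 addr0.
Qed.

Lemma hook_sum (x x' : V) (a b q : F) : 1 + a + q * a = 0 ->
  x + q *: x + (a *: x + b *: x') + (a *: (q *: x) + b *: (-1 *: x'))
    + q *: (a *: x + b *: x') + q *: (a *: (q *: x) + b *: (-1 *: x')) = 0.
Proof.
move=> m; apply/ffunP => i; rewrite !(ffun_addE, ffun_scaleE).
move: (x i : F) (x' i : F) => X X'.
transitivity ((1 + q) * X * (1 + a + q * a)); first by ring.
by rewrite m mulr0 ffunE.
Qed.

End SixTerm.

(** * Coefficients attached to pairs of nodes *)

Section Coefficients.
Variables (F : fieldType) (q : F) (d n : nat).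
Hypotheses (q_neq0 : q != 0) (q_expz_inj : injective (fun z : int => q ^ z)).
Implicit Types u v w : node d n.

Definition qcontent u : F := q ^ ncontent u.

Lemma q_neq1 : q != 1.
Proof. by apply/eqP => q1; have := @q_expz_inj 1 0; rewrite expr1z expr0z q1 => /(_ erefl). Qed.

Lemma qcontent_neq0 u : qcontent u != 0.
Proof. by rewrite expfz_neq0. Qed.

Definition diagc u v : F :=
  if u.1.1 == v.1.1 then snA q (qcontent u) (qcontent v) else 0.

(* If u and v hold consecutive entries of a standard tableau and their        *)
(* contents differ by 1, then exchanging them gives a nonstandard tableau, so *)
(* the coefficient does not matter; the value 0 makes g_vtab hold for all     *)
(* tableaux, standard or not.                                                 *)
Definition swapc u v : F :=
  if (v.1.1 < u.1.1)%N then 1 else if (u.1.1 < v.1.1)%N then q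
  else if `|ncontent u - ncontent v|%N == 1%N then 0
  else snB q (qcontent u) (qcontent v).

Definition separated u v := u.1.1 = v.1.1 -> ncontent u != ncontent v.

Lemma qcontent_neq u v : separated u v -> u.1.1 = v.1.1 -> qcontent u != qcontent v.
Proof. by move=> uv /uv; apply: contra_neq => /q_expz_inj. Qed.

Lemma diagc_add u v : separated u v ->
  diagc u v + diagc v u = (q - 1) * (u.1.1 == v.1.1)%:R.
Proof.
move=> uv; rewrite /diagc eq_sym; case: eqP => [e|_]; last by rewrite addr0 mulr0.
by rewrite mulr1 snA_add // qcontent_neq.
Qed.

Lemma diagc_cross u v : diagc u v * qcontent u + diagc v u * qcontent v = 0.
Proof.
rewrite /diagc eq_sym; case: eqP => _; first exact: snA_cross.
by rewrite !mul0r addr0.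
Qed.

Lemma diagc_right u v : u.1.1 = v.1.1 -> ncontent v = ncontent u + 1 -> diagc u v = q.
Proof.
move=> e c; rewrite /diagc e eqxx (_ : qcontent v = q * qcontent u); last first.
  by rewrite /qcontent c (expfzDr (ncontent u) 1) // expr1z mulrC.
by rewrite snA_right ?qcontent_neq0 ?q_neq1.
Qed.

Lemma diagc_down u v : u.1.1 = v.1.1 -> ncontent v = ncontent u - 1 -> diagc u v = -1.
Proof.
move=> e c; rewrite /diagc e eqxx (_ : qcontent v = q^-1 * qcontent u); last first.
  by rewrite /qcontent c (expfzDr (ncontent u) (-1)) // exprN1 mulrC.
by rewrite snA_down ?qcontent_neq0 ?q_neq1.
Qed.

Lemma swapc_adjacent u v : u.1.1 = v.1.1 ->
  `|ncontent u - ncontent v|%N = 1%N -> swapc u v = 0.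
Proof. by move=> e c; rewrite /swapc e ltnn c. Qed.

Lemma swapc_neq0 u v :
    (u.1.1 = v.1.1 -> (1 < `|ncontent u - ncontent v|)%N) -> swapc u v != 0.
Proof.
move=> far; rewrite /swapc; case: ltngtP => [_|_|/val_inj/esym e] //.
  exact: oner_neq0.
have lt := far e; rewrite (gtn_eqF lt) mulf_neq0 ?invr_neq0 // subr_eq0.
  rewrite /qcontent -{1}[q]expr1z -expfzDr //; apply/eqP => /q_expz_inj; lia.
by apply/eqP => /q_expz_inj c; move: lt; rewrite c subrr.
Qed.

Lemma swapc_mul u v : separated u v ->
  swapc u v * swapc v u = q + diagc u v * diagc v u.
Proof.
move=> uv; rewrite /swapc /diagc [v.1.1 == _]eq_sym.
case: ltngtP => [lt|lt|/val_inj/esym e].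
- by rewrite -val_eqE (gtn_eqF lt) mulr0 addr0 mul1r.
- by rewrite -val_eqE (ltn_eqF lt) mulr0 addr0 mulr1.
rewrite e eqxx; have ne := qcontent_neq uv e.
rewrite distnC; case: eqP => [c|_]; last by rewrite snB_mul.
(* For contents differing by 1 the exchange coefficient is 0, while the two diagonal coefficients
   are q and -1, with product -q. *)
rewrite mul0r; apply/esym.
have [c'|c'] : ncontent v = ncontent u + 1 \/ ncontent v = ncontent u - 1 by lia.
- have := diagc_right e c'; rewrite /diagc e eqxx => ->.
  have := @diagc_down v u (esym e); rewrite /diagc e eqxx => ->; last by lia.
  by rewrite mulrN1 subrr.
- have := diagc_down e c'; rewrite /diagc e eqxx => ->.
  have := @diagc_right v u (esym e); rewrite /diagc e eqxx => ->; last by lia.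
  by rewrite mulN1r subrr.
Qed.

Lemma diagc_braid_l u v w : separated u v -> separated u w -> separated v w ->
  diagc u v * diagc v w + diagc u w * diagc v u = diagc v w * diagc u w.
Proof.
move=> uv uw vw; rewrite /diagc; have [e|ne] := eqVneq u.1.1 v.1.1.
  rewrite -e ?eqxx; have [e'|_] := eqVneq u.1.1 w.1.1; last by rewrite !(mulr0, mul0r) addr0.
  by rewrite snA_braid_l // qcontent_neq // -e.
rewrite mulr0 mul0r add0r.
have [e|] := eqVneq u.1.1 w.1.1; last by rewrite mulr0.
by rewrite -e eq_sym (negPf ne) mul0r.
Qed.

Lemma diagc_braid_r u v w : separated u v -> separated u w -> separated v w ->
  diagc u v * diagc u w = diagc v w * diagc u v + diagc u w * diagc w v.
Proof.
move=> uv uw vw; rewrite /diagc; have [e|ne] := eqVneq v.1.1 w.1.1.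
  rewrite -e ?eqxx; have [e'|_] := eqVneq u.1.1 v.1.1; last by rewrite !(mulr0, mul0r) addr0.
  by rewrite snA_braid_r // qcontent_neq // -e.
rewrite mulr0 mul0r add0r.
have [e|] := eqVneq u.1.1 v.1.1; last by rewrite mul0r.
by rewrite e (negPf ne) mulr0.
Qed.

End Coefficients.

Section Separation.
Variables (d n : nat) (lam : 'I_d -> seq nat).
Hypothesis hlam : is_dpartition n lam.
Implicit Types T : tableau d n.

(** The range of two covers all three strands of a braid relation. *)
Lemma std_separated T (a b : 'I_n) : standard lam T -> a != b ->
  (a <= b.+2)%N -> (b <= a.+2)%N -> separated (T a) (T b).
Proof.
move=> sT; rewrite -val_eqE /= neq_ltn => /orP[] lt h1 h2 e; apply/eqP => c.
  by have := std_same_content hlam sT e c lt; lia.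
by have := std_same_content hlam sT (esym e) (esym c) lt; lia.
Qed.

Lemma lo_hi_separated T i : standard lam T -> separated (T (lo i)) (T (hi i)).
Proof. by move=> sT; apply: std_separated (lo_neq_hi i) _ _ => //=; lia. Qed.

End Separation.

(** * The seminormal representation *)

Section TableauVectors.
Variables (F : fieldType) (d n : nat) (lam : 'I_d -> seq nat).
Local Notation V := {ffun stdtab n lam -> F^o}.
Implicit Types (T : tableau d n) (v : V).

Definition tvec T : V := [ffun S : stdtab n lam => (val S == T)%:R].

Lemma tvec_nonstd T : ~~ standard lam T -> tvec T = 0.
Proof.
move=> nT; apply/ffunP => S; rewrite !ffunE.
by case: eqP => // e; rewrite -e (valP S) in nT.
Qed.

Lemma tvecE (S S' : stdtab n lam) : tvec (val S) S' = (S' == S)%:R.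
Proof. by rewrite ffunE. Qed.

Lemma tvec_expand v : v = \sum_S v S *: tvec (val S).
Proof.
apply/ffunP => S; rewrite sum_ffunE (bigD1 S) //= big1 ?addr0 => [|S' ne].
  by rewrite ffunE tvecE eqxx [_ *: _]mulr1.
by rewrite ffunE tvecE eq_sym (negPf ne) scaler0.
Qed.

Lemma linear_tvec_eq (f g : V -> V) : linear f -> linear g ->
  (forall T, standard lam T -> f (tvec T) = g (tvec T)) -> f =1 g.
Proof.
move=> fL gL fg v.
pose fl : {linear V -> V} := HB.pack f (GRing.isLinear.Build _ _ _ _ f fL).
pose gl : {linear V -> V} := HB.pack g (GRing.isLinear.Build _ _ _ _ g gL).
rewrite -[f]/(fl : _ -> _) -[g]/(gl : _ -> _) (tvec_expand v) !linear_sum.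
by apply: eq_bigr => S _; rewrite !linearZ /= fg // (valP S).
Qed.

End TableauVectors.

Section ScalarRep.
Variables (k K : comNzRingType) (phi : {rmorphism k -> K}) (A : assocAlgType k).
Variable V : lmodType K.

(** The algebra and its ground ring are left free so that the same computations apply to the free
    algebra, where the relations are still to be verified, and to [YH]. *)
Definition scalar_rep (D : A -> V -> V) : Prop :=
  [/\ forall a, linear (D a),
      forall a b v, D (a + b) v = D a v + D b v,
      forall a b v, D (a * b) v = D a (D b v) &
      forall c v, D (scal c) v = phi c *: v].

Variable D : A -> V -> V.
Hypothesis repD : scalar_rep D.

Lemma rep_linear a : linear (D a). Proof. by case: repD. Qed.
Lemma repDl a b v : D (a + b) v = D a v + D b v. Proof. by case: repD. Qed.
Lemma repM a b v : D (a * b) v = D a (D b v). Proof. by case: repD. Qed.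
Lemma rep_scal c v : D (scal c) v = phi c *: v. Proof. by case: repD. Qed.

Lemma rep1 v : D 1 v = v.
Proof. by rewrite -(scal1 (s := A)) rep_scal rmorph1 scale1r. Qed.

Lemma rep0 v : D 0 v = 0.
Proof. by apply: (addrI (D 0 v)); rewrite -repDl !addr0. Qed.

Lemma repB a b v : D (a - b) v = D a v - D b v.
Proof. by apply: (addIr (D b v)); rewrite -repDl !subrK. Qed.

Lemma repDr a v w : D a (v + w) = D a v + D a w.
Proof. by have := rep_linear a 1 v w; rewrite !scale1r. Qed.

Lemma rep0r a : D a 0 = 0.
Proof. by apply: (addrI (D a 0)); rewrite -repDr !addr0. Qed.

Lemma repZr a c v : D a (c *: v) = c *: D a v.
Proof. by have := rep_linear a c v 0; rewrite rep0r !addr0. Qed.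

Lemma repXn a m c v : D a v = c *: v -> D (a ^+ m) v = c ^+ m *: v.
Proof.
move=> av; elim: m => [|m IH]; first by rewrite !expr0 rep1 scale1r.
by rewrite exprS repM IH repZr av scalerA -exprSr.
Qed.

Lemma rep_sum (I : Type) (r : seq I) (P : pred I) (F : I -> A) v :
  D (\sum_(i <- r | P i) F i) v = \sum_(i <- r | P i) D (F i) v.
Proof. exact: (big_morph (fun a => D a v) (fun a b => repDl a b v) (rep0 v)). Qed.

End ScalarRep.

Section Seminormal.
Variables (F : fieldType) (q : F).
Hypotheses (q_neq0 : q != 0) (q_expz_inj : injective (fun z : int => q ^ z)).
Variables (d n : nat) (lam : 'I_d -> seq nat) (xi : 'I_d -> F).
Hypothesis hlam : is_dpartition n lam.
Local Notation V := {ffun stdtab n lam -> F^o}.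
Local Notation vt := (tvec F lam).
Local Notation sw T i := (tab_perm T (sgen i)).
Implicit Types (T : tableau d n) (v : V).

Definition seminormal_g (i : 'I_n.-1) T : V :=
  let u := T (lo i) in let v := T (hi i) in
  if (v.1.1 < u.1.1)%N then vt (sw T i)
  else if (u.1.1 < v.1.1)%N then q *: vt (sw T i)
  else snA q (qcontent q u) (qcontent q v) *: vt T
       + snB q (qcontent q u) (qcontent q v) *: vt (sw T i).

Variables (k : comNzRingType) (phi : {rmorphism k -> F}) (A : assocAlgType k).
Variable D : A -> V -> V.
Hypothesis repD : scalar_rep phi D.
Variables (g : 'I_n.-1 -> A) (t : 'I_n -> A).
Hypothesis gD : forall i T, standard lam T -> D (g i) (vt T) = seminormal_g i T.
Hypothesis tD : forall j T, standard lam T -> D (t j) (vt T) = xi (T j).1.1 *: vt T.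

Let DL a := rep_linear repD a.
Let DDl := repDl repD.
Let DM := repM repD.
Let DDr := repDr repD.
Let DZr := repZr repD.

Lemma t_vtab j T : D (t j) (vt T) = xi (T j).1.1 *: vt T.
Proof.
have [sT|nT] := boolP (standard lam T); first exact: tD.
by rewrite tvec_nonstd // (rep0r repD) scaler0.
Qed.

(** For nonstandard [T] with standard exchange, the two entries are consecutive in a row or column
    of the exchange, hence adjacent, and [swapc] vanishes. *)
Lemma g_vtab i T : D (g i) (vt T) =
  diagc q (T (lo i)) (T (hi i)) *: vt T + swapc q (T (lo i)) (T (hi i)) *: vt (sw T i).
Proof.
have [sT|nT] := boolP (standard lam T).
  rewrite gD // /seminormal_g /diagc /swapc.
  case: ltngtP => [lt|lt|/val_inj e].
  - by rewrite -val_eqE (gtn_eqF lt) scale0r add0r scale1r.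
  - by rewrite -val_eqE (ltn_eqF lt) scale0r add0r.
  rewrite e eqxx; have [sTs|nTs] := boolP (standard lam (sw T i)); last first.
    by rewrite (tvec_nonstd _ nTs) !scaler0.
  by rewrite (gtn_eqF (std_swap_content hlam sT sTs (esym e))).
rewrite (tvec_nonstd _ nT) (rep0r repD) scaler0 add0r.
have [sTs|nTs] := boolP (standard lam (sw T i)); last first.
  by rewrite (tvec_nonstd _ nTs) scaler0.
have rc : node_rclt (sw T i (lo i)) (sw T i (hi i)).
  by apply/negPn; apply: contra nT => /(std_swap hlam sTs); rewrite tab_swapK.
have /andP[/node_leP[p _ _] _] := node_rclt_le rc.
have := std_rclt_content hlam sTs (erefl _ : hi i = (lo i).+1 :> nat) rc.
rewrite tab_swap_lo tab_swap_hi in p *; rewrite distnC => c.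
by rewrite swapc_adjacent ?scale0r.
Qed.

Lemma rep_eq a b : (forall T, standard lam T -> D a (vt T) = D b (vt T)) -> D a =1 D b.
Proof. exact: (linear_tvec_eq (DL a) (DL b)). Qed.

Lemma rep_tt i j : D (t i * t j) =1 D (t j * t i).
Proof.
apply: rep_eq => T _; rewrite !DM (t_vtab j) (t_vtab i) !DZr (t_vtab j) (t_vtab i).
by rewrite !scalerA mulrC.
Qed.

Lemma rep_tg i j : D (t j * g i) =1 D (g i * t (sgen i j)).
Proof.
apply: rep_eq => T _; rewrite !DM t_vtab DZr g_vtab DDr !DZr !t_vtab tab_swapE.
rewrite scalerDr !scalerA [_ * swapc _ _ _]mulrC; congr (_ *: _ + _).
rewrite /diagc; case: eqP => [e|_]; last by rewrite mul0r mulr0.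
rewrite mulrC; congr (xi _ * _).
have [->|ne] := eqVneq j (lo i); first by rewrite sgenL.
have [->|ne'] := eqVneq j (hi i); first by rewrite sgenR.
by rewrite sgenD.
Qed.

Lemma rep_comm (i j : 'I_n.-1) : (i.+1 < j)%N || (j.+1 < i)%N -> D (g i * g j) =1 D (g j * g i).
Proof.
move=> ij; apply: rep_eq => T _.
have [jl jh] : sw T j (lo i) = T (lo i) /\ sw T j (hi i) = T (hi i).
  by apply: tab_swap_far; rewrite orbC.
have [il ih] := tab_swap_far T ij.
rewrite !DM (g_vtab j) (g_vtab i) !DDr !DZr !(g_vtab _ T) (g_vtab i) (g_vtab j).
rewrite jl jh il ih (tab_swapC T ij) !scalerDr !scalerA addrACA.
by congr (_ *: _ + _ *: _ + (_ *: _ + _ *: _)); rewrite mulrC.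
Qed.

Lemma rep_braid (i j : 'I_n.-1) : j = i.+1 :> nat -> D (g i * g j * g i) =1 D (g j * g i * g j).
Proof.
move=> ji; apply: rep_eq => T sT.
have e : hi i = lo j by apply: val_inj; rewrite /= ji.
have il S : sw S i (lo i) = S (lo j) by rewrite tab_swap_lo e.
have im S : sw S i (lo j) = S (lo i) by rewrite -e tab_swap_hi.
have ih S : sw S i (hi j) = S (hi j) by apply: tab_swapD => /=; lia.
have jl S : sw S j (lo i) = S (lo i) by apply: tab_swapD => /=; lia.
have jm S : sw S j (lo j) = S (hi j) by rewrite tab_swap_lo.
have jh S : sw S j (hi j) = S (lo j) by rewrite tab_swap_hi.
have gi S : D (g i) (vt S) =
    diagc q (S (lo i)) (S (lo j)) *: vt S + swapc q (S (lo i)) (S (lo j)) *: vt (sw S i).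
  by rewrite g_vtab e.
have sep_ij : separated (T (lo i)) (T (lo j)) by rewrite -e; apply: (lo_hi_separated hlam).
have sep_jh : separated (T (lo j)) (T (hi j)) by apply: (lo_hi_separated hlam).
have sep_ih : separated (T (lo i)) (T (hi j)).
  by apply: (std_separated hlam) => //=; rewrite -?val_eqE /= ji; lia.
rewrite !DM.
refine (braid_six (DL (g i)) (DL (g j)) (gi T) (g_vtab j T)
  (y1 := vt (sw T i)) (y2 := vt (sw T j)) (z12 := vt (sw (sw T i) j))
  (z21 := vt (sw (sw T j) i)) (w := vt (sw (sw (sw T i) j) i))
  _ _ _ _ _ _ (swapc_mul q_neq0 q_expz_inj sep_ij) (swapc_mul q_neq0 q_expz_inj sep_jh)
  (diagc_braid_l q_expz_inj sep_ij sep_ih sep_jh) (diagc_braid_r q_expz_inj sep_ij sep_ih sep_jh)).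
- by rewrite gi il im tab_swapK.
- by rewrite g_vtab jm jh tab_swapK.
- by rewrite g_vtab im ih.
- by rewrite gi jl jm.
- by rewrite gi jl jm il ih.
- by rewrite (tab_swap_braid T ji) g_vtab im ih jh jl.
Qed.

(** * Jucys-Murphy elements and irreducibility *)

Hypothesis xi_inj : injective xi.

(* Up to a power of q, the Jucys-Murphy elements. *)
Fixpoint murphy m : A :=
  if m is m'.+1 then
    if insub m' is Some i then g i * murphy m' * g i else 1
  else 1.

Lemma murphy_vtab m (mn : (m < n)%N) T :
  D (murphy m) (vt T) = (q ^+ m * qcontent q (T (Ordinal mn))) *: vt T.
Proof.
elim: m mn T => [|m IH] mn T.
  rewrite (rep1 repD) mul1r; have [sT|nT] := boolP (standard lam T); last first.
    by rewrite tvec_nonstd // scaler0.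
  have [x0 y0] := std_first hlam sT (erefl _ : Ordinal mn = 0%N :> nat).
  by rewrite /qcontent /ncontent x0 y0 subrr expr0z scale1r.
have mn' : (m < n.-1)%N by lia.
have [sT|nT] := boolP (standard lam T); last first.
  by rewrite tvec_nonstd // scaler0 (rep0r repD).
pose i := Ordinal mn'; have mn0 := ltnW mn.
have lE : Ordinal mn0 = lo i by apply: val_inj.
have hE : Ordinal mn = hi i by apply: val_inj.
rewrite /= insubT -/i !DM g_vtab !DDr !DZr !(IH mn0) lE hE !DZr !g_vtab.
rewrite tab_swap_lo tab_swap_hi tab_swapK exprS -mulrA !scalerA.
apply: murphy_two; first exact: (swapc_mul q_neq0 q_expz_inj (lo_hi_separated hlam sT)).
rewrite !mulrA ![_ * q ^+ m]mulrC -!mulrA -mulrDr.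
by rewrite diagc_cross mulr0.
Qed.

Lemma diag_coord a (c : stdtab n lam -> F) :
    (forall S, D a (vt (val S)) = c S *: vt (val S)) ->
  forall v S, D a v S = c S * v S.
Proof.
move=> ac v S; pose f v : V := [ffun S => (c S * v S : F^o)].
have fL : linear f.
  move=> x u w; apply/ffunP => S'; rewrite !ffunE /=.
  by rewrite mulrDr; congr (_ + _); rewrite /GRing.scale /= mulrCA.
have -> : D a v = f v; last by rewrite ffunE.
move: v; apply: (linear_tvec_eq (DL a) fL) => T sT.
have := ac (Sub T sT); rewrite /= => ->; apply/ffunP => S'; rewrite !ffunE /=.
case: eqP => [e|_]; last by rewrite mulr0 scaler0.
by congr (c _ * _); apply: val_inj; rewrite /= e.
Qed.

(** By [std_determined], some entry lies in different diagrams, detected by [t_a], or has different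
    contents, detected by a Jucys-Murphy element since the powers of q are distinct. *)
Lemma std_separation (S S' : stdtab n lam) : S != S' -> exists a c,
  (forall S, D a (vt (val S)) = c S *: vt (val S)) /\ c S != c S'.
Proof.
move=> ne; have [/forallP pE|] := boolP [forall a, (val S a).1.1 == (val S' a).1.1].
  have [/forallP cE|] := boolP [forall a, ncontent (val S a) == ncontent (val S' a)].
    case/eqP: ne; apply: val_inj.
    apply: (std_determined hlam (valP S) (valP S')) => a; exact/eqP.
  rewrite negb_forall => /existsP[a ne_a].
  exists (murphy a), (fun S : stdtab n lam => q ^+ a * qcontent q (val S a)); split=> [S0|].
    have := murphy_vtab (ltn_ord a) (val S0).
    by rewrite (_ : Ordinal _ = a) //; apply: val_inj.
  by apply: contra ne_a => /eqP/(mulfI (expf_neq0 _ q_neq0))/q_expz_inj ->.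
rewrite negb_forall => /existsP[a ne_a].
exists (t a), (fun S : stdtab n lam => xi (val S a).1.1); split=> [S0|]; first exact: t_vtab.
by apply: contra ne_a => /eqP/xi_inj ->.
Qed.

Section Stable.
Variable U : V -> Prop.
Hypotheses (U_add : forall v w, U v -> U w -> U (v + w)).
Hypotheses (U_scale : forall c v, U v -> U (c *: v)).
Hypothesis U_act : forall a v, U v -> U (D a v).

Lemma stable_project S (s : seq (stdtab n lam)) v : S \notin s -> U v -> v S != 0 ->
  exists w, [/\ U w, w S != 0 & {in s, forall S', w S' = 0}].
Proof.
move=> + Uv vS; elim: s => [|S' s IH]; first by exists v.
rewrite inE negb_or => /andP[neS /IH[w [Uw wS ws]]].
have [a [c [ac cS]]] := std_separation neS.
(* Subtracting the eigenvalue at [S'] kills that coordinate, rescales the one at [S] by a nonzero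
   factor, and keeps the zeros already obtained. *)
exists (D a w + - c S' *: w); split.
- by apply: U_add; [apply: U_act | apply: U_scale].
- rewrite ffun_addE ffun_scaleE (diag_coord ac) -mulrDl mulf_neq0 //.
  by rewrite subr_eq0.
move=> S''; rewrite inE ffun_addE ffun_scaleE (diag_coord ac) -mulrDl => /predU1P[->|].
  by rewrite subrr mul0r.
by move/ws => ->; rewrite mulr0.
Qed.

Lemma stable_full v : U v -> v != 0 -> forall w, U w.
Proof.
move=> Uv v0.
have [S vS] : exists S, v S != 0.
  apply/existsP; rewrite -negb_forall; apply: contra v0 => /forallP v0.
  by apply/eqP/ffunP => S; rewrite ffunE; apply/eqP.
pose s : seq (stdtab n lam) := [seq S' <- enum {: stdtab n lam} | S' != S].
have Ss : S \notin s by rewrite mem_filter eqxx.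
have [w [Uw wS ws]] := stable_project Ss Uv vS.
have US : U (vt (val S)).
  have -> : vt (val S) = (w S)^-1 *: w.
    apply/ffunP => S'; rewrite ffun_scaleE tvecE.
    have [->|ne] := eqVneq S' S; first by rewrite mulVf.
    have /ws -> : S' \in s by rewrite mem_filter ne mem_enum.
    by rewrite mulr0.
  exact: U_scale.
have UT T : standard lam T -> U (vt T).
  move=> sT; apply: (std_connected hlam (P := fun T => U (vt T)) _ (valP S) sT US).
  move=> i T0 sT0 sTs UT0.
  (* A nonzero exchange coefficient lets the exchanged basis vector be solved for from [g_i] applied
     to [vt T0]. *)
  have ne : swapc q (T0 (lo i)) (T0 (hi i)) != 0.
    by apply: swapc_neq0 => // p; apply: (std_swap_content hlam).
  have -> : vt (sw T0 i) = (swapc q (T0 (lo i)) (T0 (hi i)))^-1 *: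
      (D (g i) (vt T0) + - diagc q (T0 (lo i)) (T0 (hi i)) *: vt T0).
    by rewrite g_vtab addrAC -scalerDl subrr scale0r add0r scalerA mulVf // scale1r.
  by apply: U_scale; apply: U_add; [apply: U_act | apply: U_scale].
move=> x; rewrite (tvec_expand x).
have U0 : U 0 by rewrite -(scale0r v); apply: U_scale.
by apply: (big_ind U) => // S' _; apply/U_scale/UT/valP.
Qed.

End Stable.

(** * The idempotents and the generator of the ideal *)

Definition rep_e (c : k) (i : 'I_n.-1) : A :=
  scal c * \sum_(s < d) t (lo i) ^+ s * t (hi i) ^+ (d - s).

Hypothesis d_neq0 : d%:R != 0 :> F.
Hypothesis xi_root : forall a, xi a ^+ d = 1.
Variable dinv : k.
Hypothesis dinvE : phi dinv = d%:R^-1.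
Local Notation e := (rep_e dinv).

Definition same_diagram T i : bool := (T (lo i)).1.1 == (T (hi i)).1.1.

Lemma same_diagram_swap T i : same_diagram (sw T i) i = same_diagram T i.
Proof. by rewrite /same_diagram tab_swap_lo tab_swap_hi eq_sym. Qed.

Lemma e_vtab i T : D (e i) (vt T) = (same_diagram T i)%:R *: vt T.
Proof.
rewrite /rep_e /same_diagram DM (rep_sum repD).
set x := xi (T (lo i)).1.1; set y := xi (T (hi i)).1.1.
have xyE (s : 'I_d) : D (t (lo i) ^+ s * t (hi i) ^+ (d - s)) (vt T) =
    (x ^+ s * y ^+ (d - s)) *: vt T.
  rewrite DM (repXn repD _ (t_vtab (hi i) T)) DZr (repXn repD _ (t_vtab (lo i) T)).
  by rewrite scalerA mulrC.
rewrite (eq_bigr _ (fun s _ => xyE s)) -scaler_suml DZr (rep_scal repD) scalerA dinvE.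
congr (_ *: _); rewrite /x /y; case: eqP => [->|ne].
  rewrite (eq_bigr (fun=> 1)) => [|s _]; last by rewrite -exprD subnKC ?xi_root // ltnW.
  by rewrite sumr_const card_ord mulfV.
(* Distinct d-th roots of unity: factoring [y ^+ d - x ^+ d = 0] by the nonzero [y - x] makes the
   geometric sum vanish. *)
have xy : x - y != 0 by rewrite subr_eq0; apply/eqP => /xi_inj; exact: ne.
have := subrXX y x d; rewrite !xi_root subrr => /esym/eqP; rewrite mulf_eq0.
rewrite -opprB oppr_eq0 (negPf xy) /= => /eqP S0.
have -> : \sum_(s < d) x ^+ s * y ^+ (d - s) = y * \sum_(s < d) y ^+ (d.-1 - s) * x ^+ s.
  rewrite mulr_sumr; apply: eq_bigr => s _; rewrite mulrA -exprS mulrC.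
  by congr (_ ^+ _ * _); have := ltn_ord s; lia.
by rewrite S0 mulr0 mul0r.
Qed.

Lemma rep_td j : D (t j ^+ d) =1 D 1.
Proof.
apply: rep_eq => T _; rewrite (repXn repD _ (t_vtab j T)) (rep1 repD).
by rewrite xi_root scale1r.
Qed.

Lemma rep_quad i c : phi c = q ->
  D (g i ^+ 2) =1 D (scal c + (scal c - 1) * e i * g i).
Proof.
move=> cq; apply: rep_eq => T sT.
rewrite expr2 DM g_vtab DDr !DZr !g_vtab tab_swap_lo tab_swap_hi tab_swapK.
have sep := lo_hi_separated hlam (i := i) sT.
rewrite (quad_two _ _ (swapc_mul q_neq0 q_expz_inj sep)) DDl (rep_scal repD) cq; congr (_ + _).
rewrite 2!DM g_vtab; set w := _ *: vt T + _.
have ew : D (e i) w = (same_diagram T i)%:R *: w.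
  rewrite DDr !DZr !e_vtab same_diagram_swap scalerDr !scalerA.
  by congr (_ *: _ + _ *: _); rewrite mulrC.
rewrite ew (repB repD) (rep_scal repD) (rep1 repD) cq diagc_add //.
by rewrite mulrBl mul1r scalerBl -scalerA.
Qed.

Section Ideal.
Variables i j : 'I_n.-1.
Hypotheses (i0 : i = 0%N :> nat) (j1 : j = 1%N :> nat).
Local Notation z := (e i * e j).
Local Notation sum_g := (1 + g i + g j + g i * g j + g j * g i + g i * g j * g i).

Definition one_diagram T : bool := same_diagram T i && same_diagram T j.

Let hi_lo : hi i = lo j. Proof. by apply: val_inj; rewrite /= i0 j1. Qed.

Lemma one_diagram_swap T h : h = i \/ h = j -> one_diagram (sw T h) = one_diagram T.
Proof.
rewrite /one_diagram /same_diagram hi_lo.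
have ih S : sw S i (hi j) = S (hi j) by apply: tab_swapD => /=; rewrite i0 j1.
have jl S : sw S j (lo i) = S (lo i) by apply: tab_swapD => /=; rewrite i0 j1.
have il S : sw S i (lo i) = S (lo j) by rewrite tab_swap_lo hi_lo.
have im S : sw S i (lo j) = S (lo i) by rewrite -hi_lo tab_swap_hi.
case=> ->; rewrite ?il ?im ?ih ?jl ?tab_swap_lo ?tab_swap_hi;
  by apply/idP/idP => /andP[/eqP a /eqP b]; apply/andP; split; apply/eqP; congruence.
Qed.

Lemma z_vtab T : D z (vt T) = (one_diagram T)%:R *: vt T.
Proof.
rewrite [D z _]DM e_vtab DZr e_vtab scalerA /one_diagram.
by case: same_diagram; case: same_diagram; rewrite ?mulr1 ?mulr0 ?mul0r.
Qed.

(** [g h] mixes a tableau only with its exchange, and [z] has the same eigenvalue on both. *)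
Lemma z_comm_g h v : h = i \/ h = j -> D z (D (g h) v) = D (g h) (D z v).
Proof.
move=> hij; rewrite -[LHS]DM -[RHS]DM; move: v; apply: rep_eq => T _.
rewrite [LHS]DM [RHS]DM z_vtab g_vtab DDr !DZr !z_vtab g_vtab one_diagram_swap //.
rewrite scalerDr !scalerA.
by congr (_ *: _ + _ *: _); rewrite mulrC.
Qed.

Lemma sum_gE v : D sum_g v = v + D (g i) v + D (g j) v + D (g i) (D (g j) v)
  + D (g j) (D (g i) v) + D (g i) (D (g j) (D (g i) v)).
Proof. by rewrite !DDl (rep1 repD) !DM. Qed.

Lemma z_comm_sum_g v : D z (D sum_g v) = D sum_g (D z v).
Proof. by rewrite !sum_gE !DDr !z_comm_g; auto. Qed.

Lemma ideal_killed (cols : forall a, (ncolumns (lam a) <= 2)%N) v :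
  D (z * sum_g) v = 0.
Proof.
rewrite -(rep0 repD v); move: v; apply: rep_eq => T sT.
rewrite (rep0 repD) [LHS]DM z_comm_sum_g z_vtab DZr.
case: (boolP (one_diagram T)) => [/andP[/eqP pi /eqP pj]|_]; last by rewrite scale0r.
rewrite hi_lo in pi; rewrite scale1r.
have [x0 y0] := std_first hlam sT (i0 : lo i = 0%N :> nat).
have c0 : ncontent (T (lo i)) = 0 by rewrite /ncontent x0 y0.
have rc := std_second hlam sT (i0 : lo i = 0%N :> nat) (j1 : lo j = 1%N :> nat) pi.
have c01 := std_rclt_content hlam sT (_ : lo j = (lo i).+1 :> nat) rc.
have {}c01 := c01 (etrans j1 (congr1 S (esym i0))).
have gi S : D (g i) (vt S) =
    diagc q (S (lo i)) (S (lo j)) *: vt S + swapc q (S (lo i)) (S (lo j)) *: vt (sw S i).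
  by rewrite g_vtab hi_lo.
have [c1|c1] : ncontent (T (lo j)) = - 1 \/ ncontent (T (lo j)) = 1.
    by move: c01; rewrite c0; lia.
  have gx : D (g i) (vt T) = - 1 *: vt T.
    by rewrite gi swapc_adjacent // scale0r addr0 (diagc_down q_neq0 q_expz_inj) // c0 c1.
  rewrite sum_gE gx !DZr; move: (vt T) => x; rewrite !scaleN1r !subrr add0r.
  by rewrite addrAC addrK subrr.
have hj2 : hi j = 2%N :> nat by rewrite /= j1.
have c2 := std_third hlam sT (i0 : lo i = 0%N :> nat) (j1 : lo j = 1%N :> nat) hj2
  pi pj (cols _) c1.
have gx : D (g i) (vt T) = q *: vt T.
  by rewrite gi swapc_adjacent // scale0r addr0 (diagc_right q_neq0 q_expz_inj) // c0 c1.
(* Exchanging the second and third entries puts the second one below the first. *)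
have gx' : D (g i) (vt (sw T j)) = - 1 *: vt (sw T j).
  have jl : sw T j (lo i) = T (lo i) by apply: tab_swapD => /=; rewrite i0 j1.
  rewrite gi jl tab_swap_lo swapc_adjacent ?pi ?c0 ?c2 // scale0r addr0.
  by rewrite (diagc_down q_neq0 q_expz_inj) ?pi // c0 c2.
have aE : diagc q (T (lo j)) (T (hi j)) = snA q q q^-1.
  by rewrite /diagc pj eqxx /qcontent c1 c2 expr1z exprN1.
have q2 : q ^+ 2 != 1.
  by apply/eqP => q2; have /eqP := @q_expz_inj 2 0 q2.
have a0 := snA_hook q_neq0 q2; rewrite -aE in a0.
rewrite sum_gE gx !DZr g_vtab !(DDr, DZr) gx gx'.
exact: hook_sum.
Qed.

Lemma ideal_not_killed T :
    standard lam T -> (T (lo i)).1.1 = (T (lo j)).1.1 ->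
    (T (lo j)).1.1 = (T (hi j)).1.1 ->
    ncontent (T (lo j)) = ncontent (T (lo i)) + 1 ->
    ncontent (T (hi j)) = ncontent (T (lo j)) + 1 ->
  D (z * sum_g) (vt T) != 0.
Proof.
move=> sT pi pj ci cj.
have gi : D (g i) (vt T) = q *: vt T.
  rewrite g_vtab hi_lo swapc_adjacent //; last by rewrite ci; lia.
  by rewrite scale0r addr0 (diagc_right q_neq0 q_expz_inj).
have gj : D (g j) (vt T) = q *: vt T.
  rewrite g_vtab swapc_adjacent //; last by rewrite cj; lia.
  by rewrite scale0r addr0 (diagc_right q_neq0 q_expz_inj).
rewrite [D _ _]DM z_comm_sum_g z_vtab /one_diagram /same_diagram hi_lo pi pj eqxx scale1r.
rewrite sum_gE gi !DZr gj !DZr gi.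
have -> : vt T + q *: vt T + q *: vt T + q *: (q *: vt T) + q *: (q *: vt T)
    + q *: (q *: (q *: vt T)) = ((1 + q) * (1 + q + q ^+ 2)) *: vt T.
  apply/ffunP => S; rewrite !(ffun_addE, ffun_scaleE).
  by move: (vt T S : F) => X; ring.
rewrite scaler_eq0 negb_or; apply/andP; split.
  have q_expn m : (0 < m)%N -> q ^+ m != 1.
    by move=> m0; apply/eqP => qm; have := @q_expz_inj m 0 qm => -[m0']; rewrite m0' in m0.
  (* The eigenvalue divides this product, which is nonzero as q is not a root of unity. *)
  have : (q ^+ 2 - 1) * (q ^+ 3 - 1) != 0 by rewrite mulf_neq0 // subr_eq0 q_expn.
  have -> : (q ^+ 2 - 1) * (q ^+ 3 - 1) = (1 + q) * (1 + q + q ^+ 2) * (q - 1) ^+ 2 by ring.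
  by rewrite mulf_eq0 negb_or => /andP[].
apply/eqP => /ffunP/(_ (Sub T sT)); rewrite !ffunE /= eqxx => /eqP.
by rewrite oner_eq0.
Qed.

End Ideal.

End Seminormal.

(** * The criterion *)

Section EndRing.
Variables (F : fieldType) (V : vectType F).
Hypothesis V_proper : (0 < dim V)%N.

Definition endring : nzRingType := lfun_comp_nzRingType V_proper.

Definition scalar_end (c : F) : endring := c *: (\1%VF : 'End(V)).

Lemma scalar_end_additive : additive scalar_end.
Proof. by move=> a b; apply: scalerBl. Qed.

Lemma scalar_end_multiplicative : multiplicative scalar_end.
Proof.
split=> [a b|]; last exact: scale1r.
by apply/lfunP => v; rewrite !(scale_lfunE, comp_lfunE, id_lfunE) scalerA.
Qed.

HB.instance Definition _ := GRing.isAdditive.Build F endring scalar_end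
  scalar_end_additive.
HB.instance Definition _ := GRing.isMultiplicative.Build F endring scalar_end
  scalar_end_multiplicative.

Lemma scalar_end_central c b : scalar_end c * b = b * scalar_end c.
Proof.
by apply/lfunP => v; rewrite !(scale_lfunE, comp_lfunE, id_lfunE) linearZ.
Qed.

Lemma end_rep (k : comNzRingType) (phi : {rmorphism k -> F}) (A : assocAlgType k)
    (h : {rmorphism A -> endring}) : (forall c, h (scal c) = scalar_end (phi c)) ->
  scalar_rep phi (fun a v => (h a : 'End(V)) v).
Proof.
move=> hs; split=> [a c u v|a b v|a b v|c v].
- exact: linearP.
- by rewrite rmorphD; apply: add_lfunE.
- by rewrite rmorphM; apply: comp_lfunE.
- by rewrite hs; rewrite scale_lfunE id_lfunE.
Qed.

Lemma end_representation (A : assocAlgType F) (h : {rmorphism A -> endring}) :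
    (forall c, h (scal c) = scalar_end c) ->
  representation (fun a v => (h a : 'End(V)) v).
Proof. by move=> hs; have := end_rep (phi := idfun) hs. Qed.

End EndRing.

Lemma representation0 (F : fieldType) (A : assocAlgType F) (V : vectType F)
  (act : A -> V -> V) : representation act -> forall v, act 0 v = 0.
Proof. by case=> _ addA _ _ v; apply: (addrI (act 0 v)); rewrite -addA !addr0. Qed.

Section Criterion.
Variables (C F : fieldType) (phi : {rmorphism laurentPoly C -> F}) (q : F).
Hypothesis phi_q : phi (laurent_of_poly 'X) = q.
Hypotheses (q_neq0 : q != 0) (q_expz_inj : injective (fun z : int => q ^ z)).
Variables (d n : nat) (lam : 'I_d -> seq nat) (xi : 'I_d -> F).
Hypothesis hlam : is_dpartition n lam.
Hypotheses (d_gt0 : (0 < d)%N) (d_neq0 : d%:R != 0 :> F) (xi_inj : injective xi).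
Hypothesis xi_root : forall a, xi a ^+ d = 1.
Hypothesis phi_dinv : phi (laurent_of_poly (d%:R^-1)%:P) = d%:R^-1.

Local Notation V := {ffun stdtab n lam -> F^o}.
Local Notation vt := (tvec F lam).
Local Notation dinv := (laurent_of_poly (d%:R^-1)%:P).

Local Notation ext_YH := (scalarExt phi (YH C d n)).
Local Notation ext_FTL := (scalarExt phi (FTL C d n)).

Definition seminormal_action (act : ext_YH -> V -> V) : Prop :=
  [/\ representation act,
      forall j (T : tableau d n), standard lam T ->
        act (ext_in phi (YHt C d j)) (vt T) = xi (T j).1.1 *: vt T &
      forall i (T : tableau d n), standard lam T ->
        act (ext_in phi (YHg C d i)) (vt T) = seminormal_g q lam i T].

Definition irreducible_FTL : Prop :=
  exists actY : ext_YH -> V -> V, exists act : ext_FTL -> V -> V,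
    [/\ seminormal_action actY, representation act,
        forall (x : YH C d n) v,
          actY (ext_in phi x) v = act (ext_in phi (quot_pi (@ftl_gen C d n) x : FTL C d n)) v &
        irreducible act].

(** The generator of the ideal is zero in [FTL], so it acts by zero; with three columns this
    contradicts [ideal_not_killed] on the row-by-row tableau. *)
Lemma columns_of_irreducible_FTL :
  irreducible_FTL -> forall a, (ncolumns (lam a) <= 2)%N.
Proof.
case=> actY [act [[[actL actD actM actS] actt actg] repF fact _]] a.
rewrite leqNgt; apply/negP => cols.
pose D (x : YH C d n) v := actY (ext_in phi x) v.
have repD : scalar_rep phi D.
  split=> [x|x y v|x y v|c v]; rewrite /D; first exact: actL.
  - by rewrite ext_inD actD.
  - by rewrite ext_inM actM.
  - by rewrite ext_in_scal actS.
have [T [sT T1]] := std_exists hlam a.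
have n2 : (2 < n)%N.
  by apply: leq_trans cols _; rewrite /ncolumns -nth0 part_nth_le.
have i_lt : (0 < n.-1)%N by lia.
have j_lt : (1 < n.-1)%N by lia.
pose i := Ordinal i_lt; pose j := Ordinal j_lt.
have [|p0 x0 y0] := T1 (lo i); first by rewrite /=; lia.
have [|p1 x1 y1] := T1 (lo j); first by rewrite /=; lia.
have [|p2 x2 y2] := T1 (hi j); first by rewrite /=.
have := @ideal_not_killed _ q q_neq0 q_expz_inj _ _ _ _ hlam _ phi _ D repD
  (@YHg C d n) (@YHt C d n) actg actt xi_inj d_neq0 xi_root dinv phi_dinv
  i j erefl erefl T sT.
rewrite p0 p1 p2 /ncontent x0 y0 x1 y1 x2 y2 => /(_ erefl erefl erefl erefl).
set x := (_ * _); have -> : D x (vt T) = 0; last by rewrite eqxx.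
have x0' : quot_pi (@ftl_gen C d n) x = 0.
  have q0 : quot_pi (@ftl_gen C d n) 0 = 0.
    by apply: (addrI (quot_pi (@ftl_gen C d n) 0)); rewrite -quot_piD !addr0.
  rewrite -q0; apply/eqP/quot_piP; rewrite subr0; apply: IdealGen.
  by exists i, j.
have {}x0' : (quot_pi (@ftl_gen C d n) x : FTL C d n) = 0 := x0'.
have ext0 : ext_in phi (0 : FTL C d n) = 0 := ext_in0 phi _.
by rewrite /D fact x0' ext0 (representation0 repF).
Qed.

Lemma exists_operator (f : tableau d n -> V) : exists u : 'End(V),
  forall T, standard lam T -> u (vt T) = f T.
Proof.
pose u (v : V) : V := \sum_S v S *: f (val S).
have uL : linear u.
  move=> c x y; rewrite /u scaler_sumr -big_split; apply: eq_bigr => S _ /=.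
  by rewrite ffun_addE ffun_scaleE scalerDl scalerA.
pose ul : {linear V -> V} := HB.pack u (GRing.isLinear.Build _ _ _ _ u uL).
exists (linfun ul) => T sT; rewrite lfunE /= /u (bigD1 (Sub T sT)) //= big1 => [|S ne].
  by rewrite ffunE eqxx scale1r addr0.
rewrite ffunE /= (_ : (_ == _) = false) ?scale0r //.
by apply/negbTE; apply: contra ne => /eqP e; apply/eqP/val_inj.
Qed.

(** The operators of the seminormal form define a map on the free algebra, which descends to [YH] by
    the verified relations, to [FTL] by [ideal_killed], and extends to both scalar extensions. *)
Lemma irreducible_FTL_of_columns :
  (forall a, (ncolumns (lam a) <= 2)%N) -> irreducible_FTL.
Proof.
move=> cols.
have [T0 [sT0 _]] := std_exists hlam (Ordinal d_gt0).
have vt0 : vt T0 != 0.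
  apply/eqP => /ffunP/(_ (Sub T0 sT0)); rewrite !ffunE /= eqxx => /eqP.
  by rewrite oner_eq0.
have V_proper : (0 < dim V)%N.
  rewrite -dimvf lt0n dimv_eq0; apply: contra vt0 => /eqP V0.
  by rewrite -memv0 -V0 memvf.
pose E := endring V_proper.
have /fin_all_exists[G GE] i := exists_operator (seminormal_g q lam i).
have /fin_all_exists[X XE] j := exists_operator (fun T => xi (T j).1.1 *: vt T).
pose s : {rmorphism F -> E} := scalar_end V_proper.
have s_central : forall c b, (s \o phi) c * b = b * (s \o phi) c.
  by move=> c b; apply: scalar_end_central.
pose gens (x : 'I_n.-1 + 'I_n) : E := match x with inl i => G i | inr j => X j end.
have [h0 [h0s h0g]] := freeAlg_lift s_central gens.
have rep0 := end_rep h0s.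
have g0 i T : standard lam T -> (h0 (yh_g C i) : 'End(V)) (vt T) = seminormal_g q lam i T.
  by move=> sT; rewrite h0g GE.
have t0 j T : standard lam T -> (h0 (yh_t C j) : 'End(V)) (vt T) = xi (T j).1.1 *: vt T.
  by move=> sT; rewrite h0g XE.
have h0_rel x y : yh_rel d x y -> h0 x = h0 y.
  case=> [i j ij|i j ij|i j|i j|j|i]; apply/lfunP.
  - exact: (rep_comm hlam rep0 g0 ij).
  - exact: (rep_braid q_neq0 q_expz_inj hlam rep0 g0 ij).
  - exact: (rep_tt rep0 t0).
  - exact: (rep_tg hlam rep0 g0 t0).
  - exact: (rep_td rep0 t0 xi_root).
  - exact: (rep_quad q_neq0 q_expz_inj hlam rep0 g0 t0 xi_inj d_neq0 xi_root phi_dinv i phi_q).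
have [h1 [h1s h1g]] := presented_lift h0s h0g h0_rel.
have rep1 := end_rep h1s.
have g1 i T : standard lam T -> (h1 (YHg C d i) : 'End(V)) (vt T) = seminormal_g q lam i T.
  by move=> sT; rewrite h1g GE.
have t1 j T : standard lam T -> (h1 (YHt C d j) : 'End(V)) (vt T) = xi (T j).1.1 *: vt T.
  by move=> sT; rewrite h1g XE.
have h1_kill x : ftl_gen x -> h1 x = 0.
  case=> i [j [i0 j1 ->]]; apply/lfunP => v.
  by rewrite (ideal_killed q_neq0 q_expz_inj hlam rep1 g1 t1 xi_inj d_neq0 xi_root
    phi_dinv i0 j1 cols) zero_lfunE.
have [h2 [h2s h2E]] := quotAlg_lift h1s h1_kill.
have sC : forall c b, s c * b = b * s c by exact: scalar_end_central.
have [hY [hYs hYE]] := scalarExt_lift sC h1s.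
have [hF [hFs hFE]] := scalarExt_lift (A := FTL C d n) (h := h2) sC h2s.
exists (fun a v => (hY a : 'End(V)) v), (fun a v => (hF a : 'End(V)) v); split.
- split; first exact: (end_representation hYs).
  + by move=> j T sT; rewrite hYE t1.
  + by move=> i T sT; rewrite hYE g1.
- exact: (end_representation hFs).
- by move=> x v; rewrite hYE hFE h2E.
split; first by exists (vt T0).
move=> U stU; have [->|U0] := eqVneq U 0%VS; [by left | right].
apply/eqP; rewrite eqEsubv subvf; apply/subvP => w _.
(* Every element of [YH] acts through its image in [FTL], so [stable_full] applies to [U]. *)
have U_act a v : v \in U -> (h1 a : 'End(V)) v \in U.
  move=> Uv; have := stU (ext_in phi (quot_pi (@ftl_gen C d n) a : FTL C d n)) v Uv.
  by rewrite hFE h2E.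
have Upick : vpick U != 0 by rewrite vpick0.
refine (stable_full q_neq0 q_expz_inj hlam rep1 g1 t1 xi_inj
  (U := fun v => v \in U) _ _ U_act (memv_pick U) Upick w) => [v v'|c v].
- exact: memvD.
- exact: memvZ.
Qed.

End Criterion.

(** * Specialisation to the field of rational functions *)

Section QPowers.
Variable C : fieldType.
Local Notation K := {fraction {poly C}}.
Local Notation q := (qvar C).

Lemma qvar_exp_neq1 m : (0 < m)%N -> q ^+ m != 1.
Proof.
move=> m0; rewrite /qvar -tofracXn -tofrac1 tofrac_eq.
apply/eqP => /(congr1 (fun p : {poly C} => p.[0])).
by rewrite hornerXn hornerC expr0n (gtn_eqF m0) => /esym/eqP; rewrite oner_eq0.
Qed.

Lemma qvar_expzD (a b : int) : q ^ (a + b) = q ^ a * q ^ b.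
Proof. by rewrite expfzDr ?qvar_neq0. Qed.

Lemma qvar_expz_inj : injective (fun z : int => q ^ z).
Proof.
have H (z : int) : q ^ z = 1 -> z = 0.
  case: z => [[|m]|m] //; first by move=> /eqP; rewrite (negPf (@qvar_exp_neq1 m.+1 _)).
  by rewrite NegzE -exprnN => /eqP; rewrite invr_eq1 (negPf (@qvar_exp_neq1 m.+1 _)).
move=> a b /= E; apply/eqP; rewrite -subr_eq0; apply/eqP/H.
by rewrite qvar_expzD E -qvar_expzD subrr expr0z.
Qed.

End QPowers.

Section Instance.
Variables (C : fieldType) (d n : nat) (lam : 'I_d -> seq nat) (xi : 'I_d -> C).
Local Notation K := {fraction {poly C}}.
Local Notation xiq := (fun k => tofrac (xi k)%:P : K).

Lemma g_act_seminormal i (T : tableau d n) : g_act C lam i T = seminormal_g (qvar C) lam i T.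
Proof.
rewrite /g_act /seminormal_g /snA /snB /qcontent /content.
reflexivity.
Qed.

Lemma Vlam_irreducible_FTLP :
  Vlam_irreducible_FTL n lam xi <->
  irreducible_FTL (laurent_to_frac C) (qvar C) n lam xiq.
Proof.
split=> -[actY [act [[repY tY gY] repF fact irr]]]; exists actY, act.
  split; last first; [exact irr | exact fact | exact repF | split].
  - exact repY.
  - exact tY.
  - by move=> i T sT; rewrite -g_act_seminormal; apply: gY.
split; last first; [exact irr | exact fact | exact repF | split].
- exact repY.
- exact tY.
- by move=> i T sT; apply: etrans (gY i T sT) _; symmetry; apply: g_act_seminormal.
Qed.

Hypotheses (d_gt0 : (0 < d)%N) (d_neq0 : d%:R != 0 :> C) (xi_inj : injective xi).
Hypotheses (xi_root : forall k, xi k ^+ d = 1) (hlam : is_dpartition n lam).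

Lemma Vlam_irreducible_FTL_columns :
  Vlam_irreducible_FTL n lam xi <-> forall k, (ncolumns (lam k) <= 2)%N.
Proof.
have dE : d%:R = tofrac (d%:R : C)%:P by rewrite !rmorph_nat.
have d0q : d%:R != 0 :> K by rewrite dE tofrac_eq0 polyC_eq0.
have xiq_inj : injective xiq by move=> a b /eqP; rewrite tofrac_eq => /eqP/polyC_inj/xi_inj.
have xiq_root a : xiq a ^+ d = 1 by rewrite -tofracXn -polyC_exp xi_root tofrac1.
have dinvE : tofrac (d%:R^-1)%:P = d%:R^-1 :> K.
  apply: (mulfI d0q); rewrite (mulfV d0q) dE.
  transitivity (tofrac (d%:R%:P * (d%:R^-1 : C)%:P)); first by rewrite tofracM.
  by rewrite -polyCM (mulfV d_neq0) tofrac1.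
apply: (iff_trans Vlam_irreducible_FTLP); split.
  exact: (@columns_of_irreducible_FTL C K (laurent_to_frac C) _ (qvar_neq0 C)
    (@qvar_expz_inj C) d n lam _ hlam d_gt0 d0q xiq_inj xiq_root dinvE).
exact: (@irreducible_FTL_of_columns C K (laurent_to_frac C) _ erefl (qvar_neq0 C)
  (@qvar_expz_inj C) d n lam _ hlam d_gt0 d0q xiq_inj xiq_root dinvE).
Qed.

End Instance.

From mathcomp Require Import reals complex.

Theorem theorem3p10 (R : realType) (d n : nat) (hd : (0 < d)%N) (hn : (0 < n)%N)
    (xi : 'I_d -> R[i]) (xi_inj : injective xi)
    (xi_roots : forall z : R[i], z ^+ d = 1 <-> exists k, z = xi k)
    (lam : 'I_d -> seq nat) (hlam : is_dpartition n lam) :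
  Vlam_irreducible_FTL n lam xi <-> forall k, (ncolumns (lam k) <= 2)%N.
Proof.
apply: Vlam_irreducible_FTL_columns => // [|k].
  by rewrite Num.Theory.pnatr_eq0 -lt0n.
by apply/xi_roots; exists k.
Qed.
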